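(* Let $B$ be a unital commutative semi-simple Banach algebra whose maximal ideal space $X$ is connected, and let $T$ be a unital endomorphism of $B$ which is a Riesz operator, induced by the selfmap $\phi$ of $X$. Then $\bigcap_{n=0}^\infty \phi_n(X)=\{x_0\}$ for some $x_0\in X$, and $x_0$ is the unique fixed point of $\phi$.
   Context: The maximal ideal space $X$ of $B$ carries the weak-* (Gelfand) topology, and $\hat f$ denotes the Gelfand transform of $f\in B$. A unital endomorphism $T$ of $B$ (linear, multiplicative, $T1=1$) is said to be induced by a selfmap $\phi$ of $X$ if $\phi$ is weak-* continuous and $\widehat{Tf}(x)=\hat f(\phi(x))$ for all $f\in B$, $x\in X$. $\phi_n$ denotes the $n$-th iterate of $\phi$, with $\phi_0$ the identity. A bounded linear operator $T$ on a Banach space is a Riesz operator if $\lim_{n\to\infty}\left[\inf\{\|T^n-K\|: K \text{ compact}\}\right]^{1/n}=0$ (equivalently, $\lambda-T$ is Fredholm of index zero with finite ascent and descent for every nonzero $\lambda$, and the nonzero spectrum consists of eigenvalues accumulating at most at $0$). *)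

(* Defs.v *)
From HB Require Import structures.
From mathcomp Require Import all_boot all_order all_algebra.
From mathcomp Require Import all_classical all_reals all_analysis.
From mathcomp Require Import complex.
Import Order.TTheory GRing.Theory Num.Theory.
Import numFieldNormedType.Exports.
Set Implicit Arguments.
Unset Strict Implicit.
Unset Printing Implicit Defensive.
Local Open Scope ring_scope.
Local Open Scope classical_set_scope.

Section BanachAlgebraDefs.
Variable R : realType.
Variable B : completeNormedModType R[i].
Variables (mul : B -> B -> B) (one : B).

Definition is_unital_com_banach_algebra : Prop :=
  [/\ associative mul, commutative mul, left_id one mul &
      left_distributive mul +%R] /\
  [/\ (forall (a : R[i]) (f g : B), mul (a *: f) g = a *: mul f g),
      one != 0 &
      (forall f g : B, `|mul f g| <= `|f| * `|g|)].

Definition is_ideal (I : set B) : Prop :=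
  [/\ I 0, (forall f g, I f -> I g -> I (f + g)) &
      (forall f g, I g -> I (mul f g))].

Definition is_maximal_ideal (I : set B) : Prop :=
  [/\ is_ideal I, ~ I one &
      (forall J : set B, is_ideal J -> ~ J one -> I `<=` J -> J = I)].

Definition jacobson_radical : set B :=
  \bigcap_(I in is_maximal_ideal) I.

Definition semisimple : Prop := jacobson_radical = [set 0].

(* characters (= points of the maximal ideal space): nonzero
   multiplicative linear functionals, normalised by x one = 1 *)
Definition is_character (x : B -> R[i]) : Prop :=
  [/\ linear x, (forall f g, x (mul f g) = x f * x g) & x one = 1].

(* the maximal ideal space X, as a subspace of C^B with the
   pointwise (= weak-* ) topology *)
Definition max_ideal_space : set {ptws B -> R[i]^o} :=
  [set x | is_character x].

Definition unital_endomorphism (T : B -> B) : Prop :=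
  [/\ linear T, (forall f g, T (mul f g) = mul (T f) (T g)) & T one = one].

(* T is induced by the selfmap phi of X: phi is weak-* continuous and
   (Tf)^(x) = f^(phi x), where f^(x) = x f is the Gelfand transform *)
Definition induced_by (T : B -> B)
    (phi : {ptws B -> R[i]^o} -> {ptws B -> R[i]^o}) : Prop :=
  [/\ (forall x, max_ideal_space x -> max_ideal_space (phi x)),
      {within max_ideal_space, continuous phi} &
      (forall f x, max_ideal_space x -> x (T f) = phi x f)].

Definition bounded_operator (S : B -> B) : Prop :=
  linear S /\ exists M : R[i], forall f, `|S f| <= M * `|f|.

Definition opnorm (S : B -> B) : R :=
  sup [set complex.Re `|S f| | f in [set f : B | `|f| <= 1]].

Definition compact_operator (K : B -> B) : Prop :=
  linear K /\ compact (closure (K @` [set f : B | `|f| <= 1])).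

Definition ess_dist (T : B -> B) (n : nat) : R :=
  inf [set opnorm (fun f => iter n T f - K f) | K in compact_operator].

Definition riesz_operator (T : B -> B) : Prop :=
  bounded_operator T /\
  (fun n : nat => powR (ess_dist T n) (n%:R)^-1) @ \oo --> (0 : R).

End BanachAlgebraDefs.

(* Main.v *)
Require Import Defs.
From HB Require Import structures.
From mathcomp Require Import all_boot all_order all_algebra.
From mathcomp Require Import all_classical all_reals all_analysis.
From mathcomp Require Import complex ring lra.
Import Order.TTheory GRing.Theory Num.Theory.
Import numFieldNormedType.Exports.
Local Open Scope ring_scope.
Local Open Scope classical_set_scope.
Set Implicit Arguments.
Unset Strict Implicit.
Unset Printing Implicit Defensive.

(**
Let [X] be the set of characters and fix some [x] in [X].  The operator
[A f = T f - x(T f) 1] is quasi-compact: some power of it is a small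
perturbation of a compact operator.

An eigenvector of [A] for an eigenvalue of modulus at least [1] would give a
non-constant [g] with [T g = mu g], [|mu| >= 1].  As [X] is connected, [g]
takes infinitely many values on [X], so [1, g, g^2, ...] are linearly
independent eigenvectors of [T] for the eigenvalues [mu^j]; a Riesz lemma
argument along this flag contradicts quasi-compactness.  So there are no such
eigenvectors, and quasi-compactness then bounds [1 - z A] from below, uniformly
for [|z| <= 1].

Such a bound forces [|A^n| <= 1/2] for some [n].  This replaces the spectral
radius formula, and also yields the Gelfand-Mazur theorem, by which a maximal
ideal is the kernel of a character.  It comes from an averaging over roots of
unity: the inverses of [1 - z^n A^n], [n = 2^k], are averages of inverses of
[1 - w A] with [|w| = |z|], hence bounded and equicontinuous in [z] uniformly
in [n], so that the smallness of [z^n A^n] propagates from [z = 0] to [z = 1]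
in finitely many steps.

Hence [T^n f] approaches the constants, [y(T^n f) - x(T^n f)] tends to [0]
uniformly in [y] in [X], and [x0 = lim x o T^n] is the required point.
*)

(** * Linear combinations in a module *)

(* Equalities between linear combinations in a module are decided by comparing
   coefficients in the commutative ring of scalars. *)
Section LinearCombination.
Context {K : comPzRingType} {V : lmodType K}.

Inductive vterm : Type :=
| VAtom of nat
| VZero
| VAdd of vterm & vterm
| VOpp of vterm
| VScale of K & vterm.

Fixpoint veval (env : seq V) (t : vterm) : V :=
  match t with
  | VAtom i => env`_i
  | VZero => 0
  | VAdd s t => veval env s + veval env t
  | VOpp t => - veval env t
  | VScale a t => a *: veval env t
  end.

Fixpoint vcoef (t : vterm) (j : nat) : K :=
  match t with
  | VAtom i => if Nat.eqb i j then 1 else 0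
  | VZero => 0
  | VAdd s t => vcoef s j + vcoef t j
  | VOpp t => - vcoef t j
  | VScale a t => a * vcoef t j
  end.

Lemma vevalE env t : veval env t = \sum_(j < size env) vcoef t j *: env`_j.
Proof.
elim: t => /= [i||s -> t ->|t ->|a t ->].
- have [ltis|leis] := ltnP i (size env); last first.
    rewrite nth_default // big1 // => j _.
    case: PeanoNat.Nat.eqb_spec => [eij|_]; last by rewrite scale0r.
    by have := ltn_ord j; rewrite -eij ltnNge leis.
  rewrite (bigD1 (Ordinal ltis)) //= PeanoNat.Nat.eqb_refl scale1r big1 ?addr0 //.
  move=> j /eqP nej; case: PeanoNat.Nat.eqb_spec => [eij|_]; last by rewrite scale0r.
  by case: nej; apply: val_inj.
- by rewrite big1 // => j _; rewrite scale0r.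
- by rewrite -big_split /=; apply: eq_bigr => j _; rewrite scalerDl.
- by rewrite -sumrN; apply: eq_bigr => j _; rewrite scaleNr.
- by rewrite scaler_sumr; apply: eq_bigr => j _; rewrite scalerA.
Qed.

(** Unfolds to a finite conjunction with one coefficient identity per atom, so that [ring] can treat
    each of them separately. *)
Fixpoint below_all (n : nat) (P : nat -> Prop) : Prop :=
  if n is m.+1 then P m /\ below_all m P else True.

Lemma below_allP n P : below_all n P -> forall i, (i < n)%N -> P i.
Proof.
elim: n => [|n IHn] //= [Pn /IHn {}IHn] i.
by rewrite ltnS leq_eqVlt => /orP[/eqP->|/IHn].
Qed.

Lemma vterm_eq env s t :
  below_all (size env) (fun j => vcoef s j = vcoef t j) -> veval env s = veval env t.
Proof.
move=> /below_allP eq_st; rewrite !vevalE.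
by apply: eq_bigr => j _; rewrite eq_st.
Qed.
End LinearCombination.

(* Atoms are compared up to conversion: the same vector may be written with
   different instance paths. *)
Ltac vsame x y :=
  match goal with
  | |- _ => let _ := constr:(erefl x : x = y) in constr:(true)
  | |- _ => constr:(false)
  end.

(* The index of [x] in [l], or the length of [l] if there is none. *)
Ltac vindex x l :=
  lazymatch l with
  | nil => constr:(O)
  | cons ?y ?l' =>
    let b := vsame x y in
    lazymatch b with
    | true => constr:(O)
    | false => let n := vindex x l' in constr:(S n)
    end
  end.

Ltac vinsert l x :=
  lazymatch l with
  | nil => constr:(cons x l)
  | cons ?y ?l' =>
    let b := vsame x y in
    lazymatch b with
    | true => constr:(l)
    | false => let l'' := vinsert l' x in constr:(cons y l'')
    end
  end.

Ltac vcollect l e :=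
  lazymatch e with
  | (?u + ?v)%R => let l' := vcollect l u in vcollect l' v
  | (- ?u)%R => vcollect l u
  | (_ *: ?u)%R => vcollect l u
  | 0%R => l
  | _ => vinsert l e
  end.

Ltac vreify K l e :=
  lazymatch e with
  | (?u + ?v)%R => let s := vreify K l u in let t := vreify K l v in constr:(@VAdd K s t)
  | (- ?u)%R => let s := vreify K l u in constr:(@VOpp K s)
  | (?a *: ?u)%R => let s := vreify K l u in constr:(@VScale K a s)
  | 0%R => constr:(@VZero K)
  | _ => let n := vindex e l in constr:(@VAtom K n)
  end.

Ltac module_over K V :=
  lazymatch goal with
  | |- @eq ?T ?x ?y =>
    let l := vcollect (@nil T) x in
    let l := vcollect l y in
    let s := vreify K l x in
    let t := vreify K l y in
    change (@veval K V l s = @veval K V l t);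
    apply: vterm_eq; cbn [below_all size vcoef Nat.eqb]; repeat split
  end.

Ltac complex_module_eq R V := module_over [the comPzRingType of R[i]] V; try ring.

(** * Real-valued norms over the complex field *)

Section RealNorm.
Context {R : realType}.

(** Norms over [R[i]] are themselves elements of [R[i]]; their real parts live in a totally ordered
    field with suprema and linear arithmetic. *)
Definition rnorm {V : normedZmodType R[i]} (v : V) : R := complex.Re `|v|.

Section Generic.
Context {V : normedZmodType R[i]}.
Implicit Types v w : V.

Lemma rnormE v : `|v| = (rnorm v)%:C%C.
Proof. by rewrite /rnorm RRe_real // normr_real. Qed.

Lemma rnorm_le v (r : R) : (rnorm v <= r) = (`|v| <= r%:C%C).
Proof. by rewrite rnormE lecR. Qed.

Lemma rnorm_lt v (r : R) : (rnorm v < r) = (`|v| < r%:C%C).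
Proof. by rewrite rnormE ltcR. Qed.

Lemma rnorm_ge0 v : 0 <= rnorm v.
Proof. by rewrite -lecR -rnormE normr_ge0. Qed.

Lemma rnormD v w : rnorm (v + w) <= rnorm v + rnorm w.
Proof. by rewrite rnorm_le rmorphD /= -!rnormE ler_normD. Qed.

Lemma rnormN v : rnorm (- v) = rnorm v.
Proof. by rewrite /rnorm normrN. Qed.

Lemma rnormB v w : rnorm (v - w) = rnorm (w - v).
Proof. by rewrite /rnorm distrC. Qed.

Lemma rnorm_eq0 v : (rnorm v == 0) = (v == 0).
Proof.
rewrite -(normr_eq0 v) rnormE; apply/eqP/eqP => [->//|].
by move/(congr1 (@complex.Re R)).
Qed.

Lemma rnorm0 : rnorm (0 : V) = 0.
Proof. by apply/eqP; rewrite rnorm_eq0. Qed.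

Lemma rnorm_sub_le v w : rnorm v - rnorm w <= rnorm (v - w).
Proof. by rewrite lerBlDr -{1}(subrK w v) rnormD. Qed.

Lemma rnorm_small v : (forall e, 0 < e -> rnorm v <= e) -> v = 0.
Proof.
move=> small; apply/eqP; rewrite -rnorm_eq0 eq_le rnorm_ge0 andbT.
by apply/ler_addgt0Pr => e e0; rewrite add0r small.
Qed.
End Generic.

Lemma rnormM (a b : R[i]) : rnorm (a * b) = rnorm a * rnorm b.
Proof. by apply: complexI; rewrite rmorphM /= -!rnormE normrM. Qed.

Lemma rnorm1 : rnorm (1 : R[i]) = 1.
Proof. by apply: complexI; rewrite -rnormE normr1. Qed.

Lemma rnormX (a : R[i]) n : rnorm (a ^+ n) = rnorm a ^+ n.
Proof. by apply: complexI; rewrite rmorphXn /= -!rnormE normrX. Qed.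

Lemma rnormV (a : R[i]) : rnorm a^-1 = (rnorm a)^-1.
Proof. by apply: complexI; rewrite fmorphV /= -!rnormE normfV. Qed.

Lemma rnorm_real (r : R) : rnorm r%:C%C = `|r|.
Proof.
by rewrite /rnorm normc_def /= expr0n /= addr0 sqrtr_sqr.
Qed.

Lemma rnormZ (V : normedModType R[i]) a (v : V) :
  rnorm (a *: v) = rnorm a * rnorm v.
Proof. by apply: complexI; rewrite rmorphM /= -!rnormE normrZ. Qed.

Lemma half_pow_small (e : R) : 0 < e -> exists n, (2^-1 : R) ^+ n <= e.
Proof.
move=> e0; exists (Num.truncn e^-1).+1.
have t0 := truncnS_gt (e^-1).
rewrite exprVn invf_ple ?posrE ?exprn_gt0 //.
apply: (le_trans (ltW t0)).
by rewrite -natrX ler_nat ltnW // ltn_expl.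
Qed.

End RealNorm.

(** * Operators bounded below *)

Section Seminorm.
Context {R : realType} {V : lmodType R[i]}.

(** Used for the norm of [B] and for the norm of [B / I] pulled back to [B]. *)
Definition seminorm (q : V -> R) : Prop :=
  (forall f g, q (f + g) <= q f + q g) /\
  (forall a f, q (a *: f) = rnorm a * q f).

Variables (q : V -> R) (q_seminorm : seminorm q).

Lemma seminorm0 : q 0 = 0.
Proof. by rewrite -(scale0r (0 : V)) q_seminorm.2 rnorm0 mul0r. Qed.

Lemma seminormN f : q (- f) = q f.
Proof. by rewrite -scaleN1r q_seminorm.2 rnormN rnorm1 mul1r. Qed.

Lemma seminorm_ge0 f : 0 <= q f.
Proof.
have := q_seminorm.1 f (- f); rewrite subrr seminorm0 seminormN.
by lra.
Qed.

Lemma seminormB f g : q (f - g) <= q f + q g.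
Proof. by rewrite -(seminormN g) q_seminorm.1. Qed.

Lemma seminorm_distC f g : q (f - g) = q (g - f).
Proof. by rewrite -seminormN opprB. Qed.

Variable A : {linear V -> V}.

Lemma iter_linear n : linear (iter n A).
Proof.
by elim: n => [|n IHn] a f g //=; rewrite IHn linearP.
Qed.

Lemma iterZ n a f : iter n A (a *: f) = a *: iter n A f.
Proof.
by elim: n => [|n IHn] //=; rewrite IHn linearZ.
Qed.

Lemma iterB n f g : iter n A (f - g) = iter n A f - iter n A g.
Proof. by elim: n => [|n IHn] //=; rewrite IHn linearB. Qed.

Variables (C a : R).
Hypothesis A_bounded : forall f, q (A f) <= a * q f.
Hypothesis A_below : forall (z : R[i]) h, rnorm z <= 1 -> q h <= C * q (h - z *: A h).

Lemma root_neg1 k : exists2 w : R[i], rnorm w = 1 & w ^+ (2 ^ k) = -1.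
Proof.
elim: k => [|k [w w1 wk]]; first by exists (-1); rewrite ?rnormN ?rnorm1 ?expr1.
exists (sqrtc w); last by rewrite expnS exprM sqr_sqrtc.
have : rnorm (sqrtc w) ^+ 2 = 1 by rewrite -rnormX sqr_sqrtc.
by move/eqP; rewrite sqrf_eq1 => /orP[/eqP//|/eqP eN]; have := rnorm_ge0 (sqrtc w); rewrite eN; lra.
Qed.

(* [1 - z^2m A^2m = (1 - z^m A^m)(1 + z^m A^m)] and the two factors are of the
   same kind, since [- z^m = (w z)^m] with [w^m = -1]; moreover [2h] is the sum
   of the images of [h] under the two factors.  Hence the constants do not
   deteriorate with [k]. *)
Lemma resolvent_lipschitz eta k (z z' : R[i]) h h' :
  0 <= a -> 0 <= C -> 0 <= eta -> rnorm z <= 1 -> rnorm z' <= 1 -> rnorm (z - z') <= eta ->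
  forall f f', f = h - z ^+ (2 ^ k) *: iter (2 ^ k) A h ->
  f' = h' - z' ^+ (2 ^ k) *: iter (2 ^ k) A h' ->
  q (h - h') <= C * (eta * (a * C)) * q f' + C * q (f' - f).
Proof.
move=> a0 C0 eta0; elim: k z z' h h' => [|k IHk] z z' h h' z1 z'1 zz' f f' fE f'E.
  have -> : C * (eta * (a * C)) * q f' + C * q (f' - f) =
    C * (eta * (a * (C * q f')) + q (f' - f)) by ring.
  apply: (le_trans (A_below _ z1)); apply: ler_wpM2l => //.
  (* The resolvent identity, for the exponent [2 ^ 0]. *)
  have -> : h - h' - z *: A (h - h') = (z - z') *: A h' - (f' - f).
    rewrite fE f'E /= !expr1 linearB.
    complex_module_eq R V.
  apply: (le_trans (seminormB _ _)); rewrite lerD2r q_seminorm.2.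
  apply: ler_pM => //; rewrite ?rnorm_ge0 ?seminorm_ge0 //.
  apply: (le_trans (A_bounded _)); apply: ler_wpM2l => //.
  by have := A_below h' z'1; rewrite f'E /= !expr1.
set m := (2 ^ k)%N in IHk.
have n2 : (2 ^ k.+1 = m + m)%N by rewrite expnS mul2n addnn.
have [w w1 wm] := root_neg1 k; rewrite -/m in wm.
(* Each factor sends [g] to a vector whose image under the other factor is the common right-hand
   side at exponent [m + m]. So the induction hypothesis applies to [u] at [w * y] and to [v] at
   [y]. *)
have factor (y : R[i]) g u v : u = g - y ^+ m *: iter m A g ->
    v = g - (w * y) ^+ m *: iter m A g ->
    [/\ u - (w * y) ^+ m *: iter m A u = g - y ^+ (m + m) *: iter (m + m) A g,
        v - y ^+ m *: iter m A v = g - y ^+ (m + m) *: iter (m + m) A g &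
        g = 2^-1 *: (u + v)].
  move=> -> ->; rewrite /= !iterB !iterZ exprMn wm exprD iterD; split.
  - by complex_module_eq R V.
  - by complex_module_eq R V.
  - by complex_module_eq R V; field.
have w_le c : rnorm (w * c) = rnorm c by rewrite rnormM w1 mul1r.
pose u := h - z ^+ m *: iter m A h; pose v := h - (w * z) ^+ m *: iter m A h.
pose u' := h' - z' ^+ m *: iter m A h'; pose v' := h' - (w * z') ^+ m *: iter m A h'.
have [fu fv hE] := factor z h u v erefl erefl.
have [fu' fv' h'E] := factor z' h' u' v' erefl erefl.
have /= := IHk (w * z) (w * z') u u'.
rewrite -mulrBr !w_le => /(_ z1 z'1 zz' _ _ erefl erefl).
rewrite fu fu' -n2 -fE -f'E => Hu.
have /= := IHk z z' v v' z1 z'1 zz' _ _ erefl erefl.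
rewrite fv fv' -n2 -fE -f'E => Hv.
have -> : h - h' = 2^-1 *: ((u - u') + (v - v')).
  by rewrite {1}hE {1}h'E; complex_module_eq R V.
rewrite q_seminorm.2 rnormV.
have -> : rnorm (2 : R[i]) = 2.
  by have := rnorm_real (2 : R); rewrite rmorph_nat ger0_norm.
rewrite ler_pdivrMl // mulrDl mul1r.
by apply: (le_trans (q_seminorm.1 _ _)); lra.
Qed.

Lemma iter_scaled (n j : nat) (z : R[i]) f :
  iter j (fun g => z ^+ n *: iter n A g) f = z ^+ (j * n) *: iter (j * n) A f.
Proof.
elim: j => [|j IHj] /=; first by rewrite mul0n expr0 scale1r.
by rewrite IHj iterZ scalerA -exprD mulSn iterD.
Qed.

Lemma iter_contraction (D : V -> V) (c : R) (n : nat) f : 0 <= c ->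
  (forall g, q (D g) <= c * q g) -> q (iter n D f) <= c ^+ n * q f.
Proof.
move=> c0 Dc; elim: n => [|n IHn] /=; first by rewrite expr0 mul1r.
by rewrite exprS -mulrA (le_trans (Dc _)) // ler_wpM2l.
Qed.

(** The point [s] moves from 0 to 1. Exponents are powers of two because the factorisation above
    halves them. *)
Definition half_contracts (s : R) : Prop :=
  exists k, forall f, q (s%:C%C ^+ (2 ^ k) *: iter (2 ^ k) A f) <= 2^-1 * q f.

(** Iterating the contraction [2^j] times gives the exponent [2^(j+k)] and the constant
    [(1/2)^(2^j)], which is at most [(1/2)^j]. *)
Lemma half_contracts_small s e : half_contracts s -> 0 < e ->
  exists k, forall f, q (s%:C%C ^+ (2 ^ k) *: iter (2 ^ k) A f) <= e * q f.
Proof.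
move=> [k kP] /half_pow_small[j je]; exists (j + k)%N => f.
rewrite expnD -iter_scaled.
apply: (le_trans (iter_contraction _ _ _ kP)); first by rewrite invr_ge0.
apply: ler_wpM2r; first exact: seminorm_ge0.
apply: le_trans je.
by apply: ler_wiXn2l; rewrite ?invr_ge0 ?invf_le1 ?ler1n // ltnW // ltn_expl.
Qed.

Hypotheses (a0 : 0 <= a) (C0 : 0 < C).

(** The admissible step [|s - s'|] depends on [a] and [C] only, not on the exponent [k] at which the
    contraction occurs. *)
Lemma half_contracts_step (s s' : R) : `|s| <= 1 -> `|s'| <= 1 ->
  C * (`|s - s'| * (a * C)) <= 6^-1 -> half_contracts s -> half_contracts s'.
Proof.
move=> s1 s'1 ss' Hs.
have [|k kP] := half_contracts_small (e := 6^-1 / C) Hs; first by rewrite divr_gt0.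
exists k => h'.
set f' := h' - s'%:C%C ^+ (2 ^ k) *: iter (2 ^ k) A h'.
have D'E : s'%:C%C ^+ (2 ^ k) *: iter (2 ^ k) A h' = h' - f' by rewrite subKr.
(* Compare [h'] at [s'] with the vector [f'] at [s], whose image differs from [f'] by the small
   [(sA)^(2^k) f']. Both error terms are at most [q f' / 6], so [q (h' - f') <= q f' / 3]; with
   [q f' <= q h' + q (h' - f')] this gives the factor 1/2. *)
have := @resolvent_lipschitz `|s - s'| k s%:C%C s'%:C%C f' h' a0 (ltW C0) (normr_ge0 _).
rewrite !rnorm_real -rmorphB rnorm_real => /(_ s1 s'1 (lexx _) _ _ erefl erefl).
rewrite -/f' subKr D'E seminorm_distC => le1.
have le2 : C * q (s%:C%C ^+ (2 ^ k) *: iter (2 ^ k) A f') <= 6^-1 * q f'.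
  apply: (le_trans (ler_wpM2l (ltW C0) (kP f'))).
  by rewrite mulrA mulrCA divff ?mulr1 // gt_eqF.
have le3 := ler_wpM2r (seminorm_ge0 f') ss'.
have : q f' <= q h' + q (h' - f') by rewrite -{1}(subKr h' f') seminormB.
by lra.
Qed.

Lemma contraction_of_bounded_below :
  exists k, forall f, q (iter (2 ^ k) A f) <= 2^-1 * q f.
Proof.
suff [k kP] : half_contracts 1.
  by exists k => f; move: (kP f); rewrite rmorph1 expr1n scale1r.
(* [M] is so large that steps of length [1 / M] are admissible; [M] of them lead from 0 to 1. *)
set M := (Num.truncn (6 * (C * (a * C)))).+1.
have M0 : 0 < M%:R :> R by rewrite ltr0n.
have MP : C * (a * C) <= 6^-1 * M%:R.
  by have := ltW (truncnS_gt (6 * (C * (a * C)))); rewrite -/M; lra.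
suff H i : (i <= M)%N -> half_contracts (i%:R / M%:R).
  by have := H M (leqnn _); rewrite divff ?gt_eqF.
elim: i => [_|i IHi iM].
  exists 0%N => f; rewrite mul0r rmorph0 expr1 scale0r seminorm0.
  by rewrite mulr_ge0 ?invr_ge0 ?seminorm_ge0.
have frac1 j : (j <= M)%N -> `|j%:R / M%:R : R| <= 1.
  by move=> jM; rewrite ger0_norm ?divr_ge0 // ler_pdivrMr // mul1r ler_nat.
apply: half_contracts_step (IHi (ltnW iM)); rewrite ?frac1 // 1?ltnW //.
rewrite -mulrBl -natr1 opprD addNKr normrM normrN1 mul1r ger0_norm ?invr_ge0 //.
by rewrite mulrCA ler_pdivrMl // [leRHS]mulrC.
Qed.
End Seminorm.

(** * Convergence and the Neumann series *)

Definition linear_of {K : pzRingType} {V W : lmodType K} (f : V -> W) (f_lin : linear f) :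
  {linear V -> W} := HB.pack f (GRing.isLinear.Build K V W *:%R f f_lin).

Section Convergence.
Context {R : realType}.

Section Limits.
Context {V : normedZmodType R[i]}.

Definition rcvg (u : nat -> V) (l : V) : Prop :=
  forall e, 0 < e -> exists N, forall n, (N <= n)%N -> rnorm (u n - l) <= e.

Definition rcauchy (u : nat -> V) : Prop :=
  forall e, 0 < e -> exists N, forall m n, (N <= m)%N -> (N <= n)%N -> rnorm (u m - u n) <= e.

Lemma rcvg_unique (u : nat -> V) l l' : rcvg u l -> rcvg u l' -> l = l'.
Proof.
move=> ul ul'; apply/eqP; rewrite -subr_eq0; apply/eqP/rnorm_small => e e0.
have e20 : 0 < e / 2 by rewrite divr_gt0.
have [N NP] := ul _ e20; have [N' NP'] := ul' _ e20.
have := NP _ (leq_maxl N N'); have := NP' _ (leq_maxr N N').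
set n := maxn _ _ => h1 h2.
have -> : l - l' = (u n - l') - (u n - l) by rewrite opprB [RHS]addrC subrKA.
by apply: (le_trans (rnormD _ _)); rewrite rnormN; lra.
Qed.

End Limits.

Lemma pow_small (d e : R) : 0 <= d < 1 -> 0 < e -> exists n, d ^+ n <= e.
Proof.
move=> /andP[d0 d1] e0.
have : GRing.exp d @ \oo --> (0 : R) by apply: cvg_expr; rewrite ger0_norm.
move/cvgrPdist_le => /(_ e e0) [n _ /(_ n (leqnn n))] /=.
by rewrite sub0r normrN ger0_norm ?exprn_ge0 // => H; exists n.
Qed.

Context {B : completeNormedModType R[i]}.

Lemma rcauchy_rcvg (u : nat -> B) : rcauchy u -> exists l, rcvg u l.
Proof.
move=> cu.
have /cauchy_cvgP/cvg_ex[l ul] : cauchy (u @ \oo).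
  apply/cauchy_exP => e e0.
  have e0' : 0 < complex.Re e / 2.
    by move: e0; rewrite ltcE /= => /andP[_ ?]; rewrite divr_gt0.
  have eE : e = (complex.Re e)%:C%C by rewrite RRe_real // gtr0_real.
  have [N NP] := cu _ e0'; exists (u N).
  exists N => // n Nn /=.
  rewrite -ball_normE /= eE -rnorm_lt.
  by apply: (le_lt_trans (NP _ _ (leqnn N) Nn)); lra.
exists l => e e0.
have /= [] := (cvgrPdist_le _ _).1 ul e%:C%C; first by rewrite ltcR.
move=> N _ NP; exists N => n Nn.
by rewrite rnormB rnorm_le; apply: NP.
Qed.

Lemma geometric_rcauchy (u : nat -> B) (c d : R) : 0 <= d < 1 -> 0 <= c ->
  (forall n, rnorm (u n.+1 - u n) <= c * d ^+ n) -> rcauchy u.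
Proof.
move=> d01 c0 ud e e0; have /andP[d0 d1] := d01.
(* The geometric sum, with its denominator [1 - d] cleared. *)
have step n k : rnorm (u (n + k)%N - u n) * (1 - d) <= c * d ^+ n * (1 - d ^+ k).
  elim: k => [|k IHk]; first by rewrite addn0 subrr rnorm0 expr0 subrr mul0r mulr0.
  have := ud (n + k)%N.
  have : rnorm (u (n + k.+1)%N - u n) <=
     rnorm (u (n + k).+1 - u (n + k)%N) + rnorm (u (n + k)%N - u n).
    by rewrite addnS; apply: le_trans (rnormD _ _); rewrite addrA subrK.
  move=> le1 le2.
  have := ler_wpM2r (_ : 0 <= 1 - d) (le_trans le1 (lerD le2 (lexx _))).
  by rewrite exprD exprS => /(_ ltac:(lra)); lra.
have dd : 0 < 1 - d by lra.
have e'0 : 0 < e / 2 * (1 - d) / (c + 1) by rewrite !(divr_gt0, mulr_gt0) //; lra.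
have [N NP] := pow_small d01 e'0; exists N => m n Nm Nn.
have near_N k : (N <= k)%N -> rnorm (u k - u N) <= e / 2.
  move=> /subnKC <-; rewrite -(ler_pM2r dd) (le_trans (step _ _)) //.
  have le1 : c * d ^+ N <= e / 2 * (1 - d).
    have : (c + 1) * d ^+ N <= e / 2 * (1 - d).
      by rewrite mulrC -ler_pdivlMr //; lra.
    by have := exprn_ge0 N d0; lra.
  apply: le_trans le1; rewrite ler_piMr ?mulr_ge0 ?exprn_ge0 //.
  by have := exprn_ge0 (k - N) d0; lra.
have -> : u m - u n = (u m - u N) - (u n - u N) by rewrite opprB addrA subrK.
apply: (le_trans (rnormD _ _)); rewrite rnormN.
by have := near_N m Nm; have := near_N n Nn; lra.
Qed.

(** The iterates of [h |-> g + L h] from 0 are the partial sums of the series of all [L^n g]. *)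
Lemma neumann (L : {linear B -> B}) (d : R) : 0 <= d < 1 ->
  (forall f, rnorm (L f) <= d * rnorm f) -> forall g, exists h, h - L h = g.
Proof.
move=> d01 Ld g; have /andP[d0 d1] := d01.
pose u n := iter n (fun h => g + L h) 0.
have ud n : rnorm (u n.+1 - u n) <= rnorm g * d ^+ n.
  elim: n => [|n IHn]; first by rewrite /u /= linear0 addr0 subr0 expr0 mulr1.
  have -> : u n.+2 - u n.+1 = L (u n.+1 - u n).
    by rewrite linearB /u /= opprD addrACA subrr add0r.
  by apply: (le_trans (Ld _)); rewrite exprS mulrCA ler_wpM2l.
have [l ul] := rcauchy_rcvg (geometric_rcauchy d01 (rnorm_ge0 g) ud).
exists l; apply/eqP; rewrite subr_eq; apply/eqP.
apply: (@rcvg_unique _ (fun n => u n.+1)) => e e0.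
  by have [N NP] := ul e e0; exists N => n Nn; apply/NP/leqW.
have [N NP] := ul e e0; exists N => n Nn.
have -> : u n.+1 - (g + L l) = L (u n - l).
  by rewrite linearB /u /= opprD addrACA subrr add0r.
apply: (le_trans (Ld _)); apply: le_trans (NP n Nn).
by rewrite ler_piMl ?rnorm_ge0 // ltW.
Qed.
End Convergence.

(** * Commutative Banach algebras and their characters *)

Section BanachAlgebra.
Context {R : realType} {B : completeNormedModType R[i]}.
Variables (mul : B -> B -> B) (one : B).
Hypothesis B_algebra : is_unital_com_banach_algebra mul one.

Let mulC : commutative mul. Proof. by case: B_algebra => -[]. Qed.
Let mul1 : left_id one mul. Proof. by case: B_algebra => -[]. Qed.
Let mulDl : left_distributive mul +%R. Proof. by case: B_algebra => -[]. Qed.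
Let mulZl a f g : mul (a *: f) g = a *: mul f g.
Proof. by case: B_algebra => _ []. Qed.

Lemma algebra_rnormM f g : rnorm (mul f g) <= rnorm f * rnorm g.
Proof.
case: B_algebra => _ [_ _ norm_mul].
by rewrite rnorm_le rmorphM /= -!rnormE.
Qed.

Lemma algebra_mulr1 f : mul f one = f.
Proof. by rewrite mulC mul1. Qed.

Lemma algebra_mul_linear f : linear (mul f).
Proof. by move=> a g h; rewrite mulC mulDl mulZl ![mul _ f]mulC. Qed.

Definition mul_op f : {linear B -> B} := linear_of (algebra_mul_linear f).

Lemma mul_opE f g : mul_op f g = mul f g. Proof. by []. Qed.

Lemma inverse_near_one f : rnorm f < 1 -> exists h, h - mul f h = one.
Proof.
move=> f1; apply: (@neumann _ _ (mul_op f) (rnorm f)) => [|g].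
  by rewrite rnorm_ge0.
exact: algebra_rnormM.
Qed.

Section Character.
Variables (x : B -> R[i]) (x_char : is_character mul one x).

Lemma charP a f g : x (a *: f + g) = a * x f + x g.
Proof. by case: x_char => ->. Qed.

Lemma charM f g : x (mul f g) = x f * x g. Proof. by case: x_char. Qed.

Lemma char1 : x one = 1. Proof. by case: x_char. Qed.

Lemma char0 : x 0 = 0.
Proof. by have := charP (-1) 0 0; rewrite scaler0 addr0 mulN1r addNr. Qed.

Lemma charZ a f : x (a *: f) = a * x f.
Proof. by rewrite -[a *: f]addr0 charP char0 addr0. Qed.

Lemma charD f g : x (f + g) = x f + x g.
Proof. by rewrite -[f]scale1r charP mul1r scale1r. Qed.

Lemma charB f g : x (f - g) = x f - x g.
Proof. by rewrite charD -scaleN1r charZ mulN1r. Qed.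

(** If [|x f| > |f|], then [one - f / x(f)] is invertible by the Neumann series, although [x] kills
    it. *)
Lemma char_rnorm f : rnorm (x f) <= rnorm f.
Proof.
rewrite leNgt; apply/negP => lt_f.
have xf0 : x f != 0 by rewrite -rnorm_eq0 gt_eqF // (le_lt_trans (rnorm_ge0 f)).
have [|h /(congr1 x)] := @inverse_near_one ((x f)^-1 *: f).
  by rewrite rnormZ rnormV ltr_pdivrMl ?mulr1 // (le_lt_trans (rnorm_ge0 f)).
rewrite charB charM charZ mulVf // mul1r subrr char1 => /eqP.
by rewrite eq_sym oner_eq0.
Qed.
End Character.

End BanachAlgebra.

(** * Subsequences *)

Section Subsequences.
Context {R : realType}.

(** Weaker than strict monotonicity, but enough to inherit limits and directly available for
    sequences obtained by choice. *)
Definition extracts (s : nat -> nat) : Prop := forall n, (n <= s n)%N.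

Lemma extracts_comp s t : extracts s -> extracts t -> extracts (s \o t).
Proof. by move=> ss tt n; apply: leq_trans (tt n) (ss _). Qed.

Context {V : normedZmodType R[i]}.

Lemma cluster_extract (u : nat -> V) l :
  (forall e, 0 < e -> forall n, exists2 m, (n <= m)%N & rnorm (u m - l) <= e) ->
  exists2 s, extracts s & rcvg (u \o s) l.
Proof.
move=> ul.
have /choice[s sP] n : exists m, (n <= m)%N /\ rnorm (u m - l) <= 2^-1 ^+ n.
  have e0 : 0 < (2^-1 : R) ^+ n by rewrite exprn_gt0.
  by have [m] := ul _ e0 n; exists m.
exists s => [n|e /half_pow_small[N Ne]]; first by case: (sP n).
exists N => n Nn; apply: le_trans Ne; apply: (le_trans (sP n).2).
by apply: ler_wiXn2l; rewrite ?invr_ge0 ?invf_le1 ?ler1n.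
Qed.
End Subsequences.

(** * Bounded and Cauchy sequences of complex numbers *)

Section BolzanoWeierstrass.
Context {R : realType}.

Lemma extracts_increasing s : increasing_seq s -> extracts s.
Proof.
move=> /increasing_seqP s_incr; elim=> [|n IHn] //.
exact: leq_ltn_trans IHn (s_incr n).
Qed.

Lemma bounded_real_extract (u : nat -> R) : (forall n, `|u n| <= 1) ->
  exists2 s, extracts s & exists l, forall e, 0 < e ->
    exists N, forall n, (N <= n)%N -> `|u (s n) - l| <= e.
Proof.
move=> u1; have [|s /extracts_increasing ss] := @bolzano_weierstrass _ u.
  by exists 1; split => // M M1 n _; apply: le_trans (u1 n) (ltW M1).
move=> /cvg_ex[l /cvgrPdist_le ul]; exists s => //; exists l => e /ul[N _ NP].
by exists N => n Nn; rewrite distrC; apply: NP.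
Qed.

Lemma rnorm_le_ReIm (z : R[i]) : rnorm z <= `|complex.Re z| + `|complex.Im z|.
Proof.
rewrite {1}[z]complexE mulrC.
apply: (le_trans (rnormD _ _)); rewrite rnormM !rnorm_real.
have -> : rnorm ('i%C : R[i]) = 1.
  by rewrite /rnorm normc_def /= expr0n /= expr1n add0r sqrtr1.
by rewrite mulr1.
Qed.

Lemma norm_Re_le (z : R[i]) : `|complex.Re z| <= rnorm z.
Proof. by rewrite -lecR -rnormE normc_ge_Re. Qed.

Lemma norm_Im_le (z : R[i]) : `|complex.Im z| <= rnorm z.
Proof.
have := norm_Re_le (z * 'i%C); rewrite ReiNIm normrN rnormM.
suff -> : rnorm ('i%C : R[i]) = 1 by rewrite mulr1.
by rewrite /rnorm normc_def /= expr0n /= expr1n add0r sqrtr1.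
Qed.

Lemma bounded_complex_extract (z : nat -> R[i]) : (forall n, rnorm (z n) <= 1) ->
  exists2 s, extracts s & exists l, rcvg (z \o s) l.
Proof.
move=> z1.
have [n|s ss [x xP]] := @bounded_real_extract (fun n => complex.Re (z n)).
  exact: le_trans (norm_Re_le _) (z1 n).
have [n|t tt [y yP]] := @bounded_real_extract (fun n => complex.Im (z (s n))).
  exact: le_trans (norm_Im_le _) (z1 _).
exists (s \o t); first exact: extracts_comp.
exists (Complex x y) => e e0; have e20 : 0 < e / 2 by rewrite divr_gt0.
have [N NP] := xP _ e20; have [M MP] := yP _ e20.
exists (maxn N M) => n; rewrite geq_max => /andP[Nn Mn] /=.
apply: (le_trans (rnorm_le_ReIm _)).
have := NP (t n) (leq_trans Nn (tt n)); have := MP n Mn.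
by case: (z _) => /= ? ?; lra.
Qed.

(** A tail lies in the disc of radius [M]; rescaled to the unit disc it has a convergent
    subsequence, whose limit attracts the whole Cauchy sequence. *)
Lemma complex_rcauchy_rcvg (z : nat -> R[i]) : rcauchy z -> exists l, rcvg z l.
Proof.
move=> cz; have [N NP] := cz 1 ltr01.
pose M := rnorm (z N) + 1.
have M0 : 0 < M by rewrite ltr_wpDl ?rnorm_ge0.
have normM : rnorm (M%:C%C : R[i]) = M by rewrite rnorm_real gtr0_norm.
have Mne0 : (M%:C%C : R[i]) != 0 by rewrite -rnorm_eq0 normM gt_eqF.
have [n|s ss [l lP]] := @bounded_complex_extract (fun n => z (N + n)%N / M%:C%C).
  rewrite rnormM rnormV normM ler_pdivrMr // mul1r -(subrK (z N) (z _)).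
  apply: (le_trans (rnormD _ _)); rewrite addrC lerD2l.
  by apply: NP; rewrite ?leq_addr.
exists (M%:C%C * l) => e e0; have e20 : 0 < e / 2 by rewrite divr_gt0.
have e2M0 : 0 < e / 2 / M by rewrite divr_gt0.
have [N1 N1P] := cz _ e20; have [N2 N2P] := lP _ e2M0.
exists N1 => n N1n; pose m := maxn N1 N2.
have N1m : (N1 <= N + s m)%N.
  by apply: leq_trans (leq_addl _ _); apply: leq_trans (ss m); apply: leq_maxl.
have := N1P _ _ N1n N1m; have := N2P m (leq_maxr _ _); rewrite /= ler_pdivlMr //.
move=> h1 h2.
have {}h1 : rnorm (z (N + s m)%N - M%:C%C * l) <= e / 2.
  have -> : z (N + s m)%N - M%:C%C * l = (z (N + s m)%N / M%:C%C - l) * M%:C%C.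
    by rewrite mulrBl divfK // [l * _]mulrC.
  by rewrite rnormM normM.
have := rnormD (z n - z (N + s m)%N) (z (N + s m)%N - M%:C%C * l).
by rewrite addrA subrK; lra.
Qed.
End BolzanoWeierstrass.

(** * Uniform lower bounds on the unit disc *)

Section UniformBound.
Context {R : realType} {V : lmodType R[i]} (q : V -> R) (A : {linear V -> V}) (a : R).
Hypotheses (q_seminorm : seminorm q) (a0 : 0 <= a) (A_bounded : forall f, q (A f) <= a * q f).

(** Compactness of the disc: parameters at which ever larger constants fail accumulate at some [z],
    and the bound at [z] persists nearby. *)
Lemma uniformly_bounded_below :
  (forall z, rnorm z <= 1 -> exists c, forall h, q h <= c * q (h - z *: A h)) ->
  exists2 C, 0 < C & forall z h, rnorm z <= 1 -> q h <= C * q (h - z *: A h).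
Proof.
move=> below; apply: contrapT => no_bound.
have /choice[p pP] n : exists p : R[i] * V, rnorm p.1 <= 1 /\
    n.+1%:R * q (p.2 - p.1 *: A p.2) < q p.2.
  apply: contrapT => no_p; apply: no_bound; exists n.+1%:R; first by rewrite ltr0n.
  move=> z h z1; rewrite leNgt; apply/negP => lt_h.
  by apply: no_p; exists (z, h).
have [n|s ss [z zP]] := @bounded_complex_extract _ (fun n => (p n).1); first by case: (pP n).
have z1 : rnorm z <= 1.
  apply/ler_addgt0Pr => e e0; have [N NP] := zP e e0.
  have := NP N (leqnn N); rewrite /= rnormB => H.
  have := rnorm_sub_le z (p (s N)).1; have := (pP (s N)).1; lra.
have [c cP] := below z z1.
set d := `|c| + 1; have d0 : 0 < d by rewrite ltr_wpDl.
have dP h : q h <= d * q (h - z *: A h).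
  apply: (le_trans (cP h)); apply: ler_wpM2r; first exact: seminorm_ge0.
  by rewrite /d; have := ler_norm c; lra.
have da0 : 0 < d * (a + 1) by rewrite mulr_gt0 // ltr_wpDl.
(* The change of parameter and the defect [r] will each cost at most [q h / 4], so that
   [q h <= q h / 2], against [0 < q h]. *)
have e0 : 0 < 4^-1 / (d * (a + 1)) by rewrite divr_gt0.
have [N NP] := zP _ e0.
pose M := Num.truncn (4 * d); pose n := maxn N M.
have := NP n (leq_maxl N M); rewrite /=; have [_] := pP (s n).
set w := (p (s n)).1; set h := (p (s n)).2 => lt_h wz.
set r := q (h - w *: A h) in lt_h.
have r0 : 0 <= r by exact: seminorm_ge0.
have h0 : 0 < q h by apply: le_lt_trans lt_h; rewrite mulr_ge0.
have rd : 4 * d * r <= q h.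
  apply: le_trans (ltW lt_h); apply: ler_wpM2r => //.
  apply: (le_trans (ltW (truncnS_gt (4 * d)))); rewrite ler_nat ltnS.
  exact: leq_trans (leq_maxr N M) (ss n).
have : q h <= d * (r + rnorm (w - z) * (a * q h)).
  apply: (le_trans (dP h)); rewrite ler_pM2l //.
  have -> : h - z *: A h = (h - w *: A h) + (w - z) *: A h.
    by rewrite scalerBl addrA subrK.
  apply: (le_trans (q_seminorm.1 _ _)); rewrite lerD2l q_seminorm.2.
  by apply: ler_wpM2l; rewrite ?rnorm_ge0.
have : rnorm (w - z) * (d * (a + 1)) <= 4^-1.
  by rewrite -ler_pdivlMr.
move=> le1.
have le2 : rnorm (w - z) * d * a <= 4^-1.
  apply: le_trans le1; have := rnorm_ge0 (w - z).
  by move: (rnorm _) => y y0; rewrite -mulrA !(ler_wpM2l, ltW d0) //; lra.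
have := ler_wpM2r (ltW h0) le2.
by lra.
Qed.
End UniformBound.

(** * The Gelfand-Mazur theorem *)

Section GelfandMazur.
Context {R : realType} {B : completeNormedModType R[i]}.
Variables (mul : B -> B -> B) (one : B).
Hypothesis B_algebra : is_unital_com_banach_algebra mul one.

Let mulA : associative mul. Proof. by case: B_algebra => -[]. Qed.
Let mulC : commutative mul. Proof. by case: B_algebra => -[]. Qed.
Let mul1 : left_id one mul. Proof. by case: B_algebra => -[]. Qed.
Let mulDl : left_distributive mul +%R. Proof. by case: B_algebra => -[]. Qed.
Let mulZl a f g : mul (a *: f) g = a *: mul f g.
Proof. by case: B_algebra => _ []. Qed.
Let mulBr f g h : mul f (g - h) = mul f g - mul f h.
Proof. exact: (linearB (mul_op B_algebra f)). Qed.
Let mulZr f a g : mul f (a *: g) = a *: mul f g.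
Proof. by rewrite mulC mulZl mulC. Qed.
Let mul_zero f : mul f 0 = 0.
Proof. exact: (linear0 (mul_op B_algebra f)). Qed.
Let mulBl f g h : mul (f - g) h = mul f h - mul g h.
Proof. by rewrite ![mul _ h]mulC mulBr. Qed.

Section MaximalIdeal.
Variables (I : set B) (I_max : is_maximal_ideal mul one I).

Lemma ideal0 : I 0. Proof. by case: I_max => -[]. Qed.
Lemma idealD f g : I f -> I g -> I (f + g).
Proof. by case: I_max => -[_ H _] _ _; apply: H. Qed.
Lemma idealM f g : I g -> I (mul f g).
Proof. by case: I_max => -[_ _ H] _ _; apply: H. Qed.
Lemma ideal_one : ~ I one. Proof. by case: I_max. Qed.
Lemma idealZ a f : I f -> I (a *: f).
Proof. by move=> If; rewrite -[f]mul1 -mulZl; apply: idealM. Qed.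
Lemma idealB f g : I f -> I g -> I (f - g).
Proof. by move=> If Ig; rewrite -scaleN1r; apply/idealD/idealZ. Qed.

(** [J] is the ideal [I + B f]; it contains [f], so by maximality it contains [one]. *)
Lemma invertible_mod_ideal f : ~ I f -> exists b, I (mul b f - one).
Proof.
move=> If; pose J : set B := [set g | exists b, I (g - mul b f)].
have J_ideal : is_ideal mul J.
  split=> [|g h [b Ib] [c Ic]|g h [b Ib]].
  - by exists 0; rewrite mulC mul_zero subr0; apply: ideal0.
  - by exists (b + c); rewrite mulDl opprD addrACA; apply: idealD.
  - by exists (mul g b); rewrite -mulA -mulBr; apply: idealM.
apply: contrapT => no_b; case: I_max => _ _ /(_ J J_ideal) JI.
apply: If; rewrite -JI => [|[b Ib]|g Ig].
- by exists one; rewrite mul1 subrr; apply: ideal0.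
- by apply: no_b; exists b; rewrite -opprB -scaleN1r; apply: idealZ.
- by exists 0; rewrite mulC mul_zero subr0.
Qed.

(** The norm of [B / I] pulled back to [B], which avoids forming the quotient. *)
Definition quotient_norm (f : B) : R := inf [set rnorm (f - i) | i in I].
Local Notation q := quotient_norm.

Lemma quotient_norm_le f i : I i -> q f <= rnorm (f - i).
Proof.
move=> Ii; apply: ge_inf; last by exists i.
by exists 0 => _ [j _ <-]; apply: rnorm_ge0.
Qed.

Lemma le_quotient_norm f r : (forall i, I i -> r <= rnorm (f - i)) -> r <= q f.
Proof.
move=> rP; apply: lb_le_inf; first by exists (rnorm (f - 0)); exists 0 => //; apply: ideal0.
by move=> _ [i Ii <-]; apply: rP.
Qed.

Lemma le_mul_quotient_norm f a r : 0 <= a ->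
  (forall i, I i -> r <= a * rnorm (f - i)) -> r <= a * q f.
Proof.
rewrite le_eqVlt => /orP[/eqP <- /(_ _ ideal0)|a0 rP]; first by rewrite !mul0r.
rewrite -ler_pdivrMl //; apply: le_quotient_norm => i Ii.
by rewrite ler_pdivrMl //; apply: rP.
Qed.

Lemma quotient_norm_ge0 f : 0 <= q f.
Proof. by apply: le_quotient_norm => i _; apply: rnorm_ge0. Qed.

Lemma quotient_norm_seminorm : seminorm q.
Proof.
have qZ a f : q (a *: f) <= rnorm a * q f.
  apply: le_mul_quotient_norm => [|i Ii]; first exact: rnorm_ge0.
  by rewrite -rnormZ scalerBr; apply/quotient_norm_le/idealZ.
split=> [f g|a f].
  rewrite -lerBlDl; apply: le_quotient_norm => j Ij.
  rewrite lerBlDl -lerBlDr; apply: le_quotient_norm => i Ii; rewrite lerBlDr.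
  apply: le_trans (rnormD _ _); rewrite addrACA -opprD.
  by apply/quotient_norm_le/idealD.
have [->|a0] := eqVneq a 0.
  apply/eqP; rewrite rnorm0 mul0r eq_le quotient_norm_ge0 andbT scale0r.
  by have := quotient_norm_le 0 ideal0; rewrite subrr rnorm0.
apply/eqP; rewrite eq_le qZ /=.
have a0' : 0 < rnorm a by rewrite lt_neqAle rnorm_ge0 eq_sym rnorm_eq0 a0.
rewrite -ler_pdivlMl // -rnormV; apply: le_trans (qZ _ _).
by rewrite scalerA mulVf // scale1r.
Qed.

Lemma quotient_norm_mod f g : I (f - g) -> q f <= q g.
Proof.
move=> Ifg; apply: le_quotient_norm => i Ii.
have -> : g - i = f - ((f - g) + i) by rewrite opprD addrA subKr.
by apply/quotient_norm_le/idealD.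
Qed.

Lemma quotient_normM a f : q (mul a f) <= rnorm a * q f.
Proof.
apply: le_mul_quotient_norm => [|i Ii]; first exact: rnorm_ge0.
apply: le_trans (algebra_rnormM B_algebra _ _).
by rewrite mulBr; apply/quotient_norm_le/idealM.
Qed.

(** An element of [I] at distance less than 1 from [one] would be invertible. *)
Lemma quotient_norm_one : 1 <= q one.
Proof.
apply: le_quotient_norm => i Ii; rewrite leNgt; apply/negP => lt1.
have [h] := inverse_near_one B_algebra lt1.
rewrite mulBl mul1 subKr => hE; apply: ideal_one.
by rewrite -hE mulC; apply: idealM.
Qed.

(** Modulo [I], [h] equals [b f h]. *)
Lemma quotient_norm_inverse b f h : I (mul b f - one) -> q h <= rnorm b * q (mul f h).
Proof.
move=> Ib; apply: le_trans (quotient_normM _ _); apply: quotient_norm_mod.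
rewrite mulA -[X in X - _]mul1 -mulBl mulC; apply: idealM.
by rewrite -opprB -scaleN1r; apply: idealZ.
Qed.

(* If no [f - c] lay in [I], all operators [1 - z f] on [B / I] would be
   invertible, so that [(t f)^n] would tend to [0] for all [t]; but [f] is
   itself invertible modulo [I]. *)
Lemma scalar_mod_ideal f : exists c, I (f - c *: one).
Proof.
apply: contrapT => no_c.
have [b Ib] : exists b, I (mul b f - one).
  by apply: invertible_mod_ideal => If; apply: no_c; exists 0; rewrite scale0r subr0.
(* The factor [|b|] makes [A] expanding for the quotient norm, so its powers cannot shrink [one]. *)
pose A := mul_op B_algebra ((rnorm b)%:C%C *: f).
have AE h : A h = (rnorm b)%:C%C *: mul f h by rewrite /A mul_opE mulZl.
have A_bounded h : q (A h) <= rnorm ((rnorm b)%:C%C *: f) * q h.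
  exact: quotient_normM.
have [|C C0 CP] := uniformly_bounded_below quotient_norm_seminorm (rnorm_ge0 _) A_bounded.
  move=> z z1; set w := z * (rnorm b)%:C%C.
  have zA h : z *: A h = w *: mul f h by rewrite AE scalerA.
  (* For [w] nonzero, [1 - w f = - w (f - 1/w)], and [f - 1/w] has an inverse [b'] modulo [I]. *)
  have [w0|w0] := eqVneq w 0.
    by exists 1 => h; rewrite zA w0 scale0r subr0 mul1r.
  have [|b' Ib'] := @invertible_mod_ideal (f - w^-1 *: one).
    by move=> If; apply: no_c; exists w^-1.
  exists (rnorm b' * rnorm w^-1) => h.
  apply: (le_trans (quotient_norm_inverse _ Ib')).
  rewrite -mulrA -quotient_norm_seminorm.2; apply: ler_wpM2l; first exact: rnorm_ge0.
  rewrite zA scalerBr scalerA mulVf // scale1r mulBl mulZl mul1.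
  by rewrite -[X in _ <= X](seminormN quotient_norm_seminorm) opprB.
have [k /(_ one)] := contraction_of_bounded_below quotient_norm_seminorm A_bounded
  CP (rnorm_ge0 _) C0.
have A_expands n : q one <= q (iter n A one).
  elim: n => [|n IHn]; [exact: lexx | apply: (le_trans IHn)].
  rewrite iterS AE quotient_norm_seminorm.2 rnorm_real ger0_norm ?rnorm_ge0 //.
  exact: quotient_norm_inverse.
by have := A_expands (2 ^ k)%N; have := quotient_norm_one; lra.
Qed.

(** [x f] is the scalar congruent to [f] modulo [I]. It is unique since [I] contains no nonzero
    scalar, and uniqueness yields linearity and multiplicativity. *)
Lemma max_ideal_character : exists2 x, is_character mul one x & forall f, x f = 0 -> I f.
Proof.
have /choice[x xP] := scalar_mod_ideal; exists x; last first.
  by move=> f xf; have := xP f; rewrite xf scale0r subr0.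
have x_unique c f : I (f - c *: one) -> x f = c.
  move=> Ic; apply/eqP; rewrite -subr_eq0; apply/eqP; apply: contrapT => /eqP d0.
  apply: ideal_one; rewrite -[one]scale1r -(mulVf d0) -scalerA; apply: idealZ.
  have -> : (x f - c) *: one = (f - c *: one) - (f - x f *: one).
    by rewrite scalerBl opprB [RHS]addrC subrKA.
  exact: idealB.
split=> [a f g|f g|].
- apply: x_unique.
  have -> : a *: f + g - (a *: x f + x g) *: one = a *: (f - x f *: one) + (g - x g *: one).
    by rewrite scalerDl opprD addrACA scalerBr scalerA.
  by apply: idealD => //; apply: idealZ.
- apply: x_unique.
  have -> : mul f g - (x f * x g) *: one = mul f (g - x g *: one) + x g *: (f - x f *: one).
    by rewrite mulBr mulZr (algebra_mulr1 B_algebra) scalerBr scalerA mulrC subrKA.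
  by apply: idealD; [apply: idealM | apply: idealZ].
- by apply: x_unique; rewrite scale1r subrr; apply: ideal0.
Qed.
End MaximalIdeal.

Hypothesis B_semisimple : semisimple mul one.

Lemma semisimple_eq0 f : (forall x, is_character mul one x -> x f = 0) -> f = 0.
Proof.
move=> xf; have : jacobson_radical mul one f; last by rewrite B_semisimple.
move=> I I_max; have [x x_char] := max_ideal_character I_max.
by apply; apply: xf.
Qed.

(** Without characters, [semisimple_eq0] would hold vacuously for [one]. *)
Lemma exists_character : exists x, is_character mul one x.
Proof.
apply: contrapT => no_x; case: B_algebra => _ [_ /eqP one0 _]; apply: one0.
by apply: semisimple_eq0 => x x_char; case: no_x; exists x.
Qed.
End GelfandMazur.

(** * Quasi-compact operators *)

Section QuasiCompact.
Context {R : realType} {B : completeNormedModType R[i]}.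

Definition seq_compact (K : B -> B) : Prop :=
  forall u, (forall n, rnorm (u n) <= 1) ->
    exists2 s, extracts s & exists l, rcvg (fun n => K (u (s n))) l.

Section BoundedBelow.
Variables (A K : {linear B -> B}) (a d : R) (N : nat).
Hypotheses (a0 : 0 <= a) (A_bounded : forall f, rnorm (A f) <= a * rnorm f).
Hypotheses (K_compact : seq_compact K) (d1 : d < 1).
Hypothesis AK : forall f, rnorm (iter N A f - K f) <= d * rnorm f.

(** [1 - z A] divides [1 - z^n A^n]: a vector nearly fixed by [z A] is nearly fixed by [z^N A^N],
    which is close to [z^N K]. *)
Lemma telescope_bound n (z : R[i]) : rnorm z <= 1 -> exists2 C, 0 <= C &
  forall h, rnorm (h - z ^+ n *: iter n A h) <= C * rnorm (h - z *: A h).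
Proof.
move=> z1; elim: n => [|n [C C0 IHn]].
  by exists 0 => // h; rewrite expr0 scale1r subrr rnorm0 mul0r.
exists (1 + a * C) => [|h]; first by rewrite addr_ge0 ?mulr_ge0.
have -> : h - z ^+ n.+1 *: iter n.+1 A h =
    (h - z *: A h) + z *: A (h - z ^+ n *: iter n A h).
  by rewrite (linearB A) (linearZZ A) iterS scalerBr scalerA -exprS addrA subrK.
apply: (le_trans (rnormD _ _)); rewrite mulrDl mul1r lerD2l rnormZ.
apply: (@le_trans _ _ (rnorm (A (h - z ^+ n *: iter n A h)))).
  by rewrite ler_piMl ?rnorm_ge0.
by apply: (le_trans (A_bounded _)); rewrite -mulrA ler_wpM2l.
Qed.

Hypothesis no_eigenvector :
  forall mu f, 1 <= rnorm mu -> A f = mu *: f -> f = 0.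

(* A bounded sequence of approximate solutions of [h = z A h] has a convergent
   subsequence, because [1 - z^N (A^N - K)] is bounded below. *)
Lemma quasi_compact_bounded_below z : rnorm z <= 1 ->
  exists c, forall h, rnorm h <= c * rnorm (h - z *: A h).
Proof.
move=> z1; apply: contrapT => no_c.
(* Failure of the constant [2^n] gives, after scaling, a unit vector with defect at most [2^-n]. *)
have /choice[u uP] n : exists u, rnorm u = 1 /\ rnorm (u - z *: A u) <= 2^-1 ^+ n.
  apply: contrapT => no_u; apply: no_c; exists (2 ^+ n) => h.
  rewrite leNgt; apply/negP => lt_h; apply: no_u.
  have h0 : 0 < rnorm h.
    by apply: le_lt_trans lt_h; rewrite mulr_ge0 ?exprn_ge0 ?rnorm_ge0.
  have normV : rnorm ((rnorm h)^-1%:C%C : R[i]) = (rnorm h)^-1.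
    by rewrite rnorm_real ger0_norm ?invr_ge0 ?rnorm_ge0.
  exists ((rnorm h)^-1%:C%C *: h); rewrite rnormZ normV mulVf ?gt_eqF //; split=> //.
  rewrite (linearZZ A) scalerA [z * _]mulrC -scalerA -scalerBr rnormZ normV.
  by rewrite ler_pdivrMl // exprVn ler_pdivlMr ?exprn_gt0 // mulrC ltW.
have [|s ss [g gP]] := K_compact (u := u); first by move=> n; rewrite (uP n).1.
pose w n := u (s n).
have w_small e : 0 < e -> exists M, forall n, (M <= n)%N -> rnorm (w n - z *: A (w n)) <= e.
  move=> /half_pow_small[M Me]; exists M => n Mn.
  apply: le_trans Me; apply: (le_trans (uP (s n)).2).
  by apply: ler_wiXn2l; rewrite ?invr_ge0 ?invf_le1 ?ler1n // (leq_trans Mn).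
have [C C0 CP] := telescope_bound N z1.
have dd : 0 < 1 - d by rewrite subr_gt0.
have wc : rcauchy w.
  move=> e e0.
  have e'0 : 0 < e * (1 - d) / 4 by rewrite divr_gt0 // mulr_gt0.
  have e''0 : 0 < e * (1 - d) / 4 / (C + 1) by rewrite divr_gt0 // ltr_wpDl.
  have [M1 M1P] := gP _ e'0; have [M2 M2P] := w_small _ e''0.
  have defect n : (M2 <= n)%N -> rnorm (w n - z ^+ N *: iter N A (w n)) <= e * (1 - d) / 4.
    move=> /M2P; rewrite ler_pdivlMr ?ltr_wpDl // => H; apply: (le_trans (CP _)).
    apply: le_trans H; rewrite mulrC ler_wpM2l ?rnorm_ge0 //; lra.
  exists (maxn M1 M2) => m n; rewrite !geq_max => /andP[M1m M2m] /andP[M1n M2n].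
  have := M1P m M1m; have := M1P n M1n; rewrite -/(w m) -/(w n).
  have := defect m M2m; have := defect n M2n.
  set x := w m; set y := w n => dy dx Ky Kx.
  rewrite -(ler_pM2r dd).
  set D := iter N A (x - y) - K (x - y).
  (* The last term is at most [d |x - y|] and is absorbed by the factor [1 - d]; the two defects and
     the two distances to [g] contribute a quarter of [e (1 - d)] each. *)
  have DE : x - y = (x - z ^+ N *: iter N A x) - (y - z ^+ N *: iter N A y)
     + z ^+ N *: ((K x - g) - (K y - g)) + z ^+ N *: D.
    by rewrite /D iterB (linearB K); complex_module_eq R B.
  have zN (v : B) : rnorm (z ^+ N *: v) <= rnorm v.
    by rewrite rnormZ rnormX ler_piMl ?rnorm_ge0 // exprn_ile1 ?rnorm_ge0.
  have := rnormD ((x - z ^+ N *: iter N A x) - (y - z ^+ N *: iter N A y)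
     + z ^+ N *: ((K x - g) - (K y - g))) (z ^+ N *: D); rewrite -DE.
  have := rnormD ((x - z ^+ N *: iter N A x) - (y - z ^+ N *: iter N A y))
     (z ^+ N *: ((K x - g) - (K y - g))).
  have := rnormD (x - z ^+ N *: iter N A x) (- (y - z ^+ N *: iter N A y)).
  have := rnormD (K x - g) (- (K y - g)).
  have := zN (K x - g - (K y - g)); have := zN D; have := AK (x - y).
  by rewrite -/D !rnormN; lra.
have [l wl] := rcauchy_rcvg wc.
have l_fix : l - z *: A l = 0.
  apply: rnorm_small => e e0.
  have e1 : 0 < e / 2 by rewrite divr_gt0.
  have e2 : 0 < e / 2 / (1 + a) by rewrite divr_gt0 // ltr_wpDr.
  have [M1 M1P] := w_small _ e1; have [M2 M2P] := wl _ e2.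
  have := M1P _ (leq_maxl M1 M2); have := M2P _ (leq_maxr M1 M2).
  set x := w _; rewrite ler_pdivlMr ?ltr_wpDr // => xl xA.
  have -> : l - z *: A l = (x - z *: A x) - ((x - l) - z *: A (x - l)).
    by rewrite (linearB A); complex_module_eq R B.
  apply: (le_trans (rnormD _ _)); rewrite rnormN.
  have := rnormD (x - l) (- (z *: A (x - l))); rewrite rnormN rnormZ.
  have : rnorm z * rnorm (A (x - l)) <= a * rnorm (x - l).
    by apply: le_trans (A_bounded _); rewrite ler_piMl ?rnorm_ge0.
  by lra.
have lE : l = z *: A l by apply/eqP; rewrite -subr_eq0 l_fix.
(* The eigenvalue will be [1 / z]; for [z = 0] the limit [l] of unit vectors would vanish. *)
have z0 : z != 0.
  apply/eqP => z0; have e0 : 0 < (2^-1 : R) by rewrite invr_gt0.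
  have [M MP] := wl _ e0; have := MP M (leqnn M).
  rewrite lE z0 scale0r subr0 /w (uP _).1; lra.
have l0 : l = 0.
  apply: (@no_eigenvector z^-1); last by rewrite {2}lE scalerA mulVf // scale1r.
  by rewrite rnormV invf_ge1 // lt_neqAle rnorm_ge0 eq_sym rnorm_eq0 z0.
have e0 : 0 < (2^-1 : R) by rewrite invr_gt0.
have [M MP] := wl _ e0; have := MP M (leqnn M).
rewrite l0 subr0 /w (uP _).1; lra.
Qed.
End BoundedBelow.

(** * Infinite flags of eigenvectors *)

Section InfinitelyManyEigenvectors.
Variables (S K : {linear B -> B}) (d : R).
Hypotheses (K_compact : seq_compact K) (d_small : d <= 16^-1).
Hypothesis SK : forall f, rnorm (S f - K f) <= d * rnorm f.
Variables (e : nat -> B) (mu : nat -> R[i]).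
Hypotheses (S_eigen : forall j, S (e j) = mu j *: e j) (mu_ge1 : forall j, 1 <= rnorm (mu j)).

Definition initial_span (j : nat) : set B :=
  [set f | exists c : nat -> R[i], f = \sum_(l < j) c l *: e l].

(** Quantitative linear independence, in place of the closedness of the span in the Riesz lemma. *)
Hypothesis separated : forall j, exists2 M, 0 < M &
  forall f, initial_span j f -> 1 <= M * rnorm (e j - f).

Lemma initial_spanP j a f g :
  initial_span j f -> initial_span j g -> initial_span j (a *: f + g).
Proof.
move=> [b ->] [c ->]; exists (fun l => a * b l + c l).
by rewrite scaler_sumr -big_split; apply: eq_bigr => l _ /=; rewrite scalerDl scalerA.
Qed.

Lemma initial_span0 j : initial_span j 0.
Proof. by exists (fun=> 0); rewrite big1 // => l _; rewrite scale0r. Qed.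

Lemma initial_spanZ j a f : initial_span j f -> initial_span j (a *: f).
Proof. by move=> jf; rewrite -[_ *: f]addr0; apply: initial_spanP => //; apply: initial_span0. Qed.

Lemma initial_spanD j f g : initial_span j f -> initial_span j g -> initial_span j (f + g).
Proof. by move=> jf jg; rewrite -[f]scale1r; apply: initial_spanP. Qed.

Lemma initial_spanB j f g : initial_span j f -> initial_span j g -> initial_span j (f - g).
Proof. by move=> jf jg; rewrite addrC -scaleN1r; apply: initial_spanP. Qed.

Lemma initial_span_basis l j : (l < j)%N -> initial_span j (e l).
Proof.
move=> lj; exists (fun k => (k == l)%:R); rewrite (bigD1 (Ordinal lj)) //= eqxx scale1r.
rewrite big1 ?addr0 // => k /eqP kl; case: eqP => [kE|_]; last by rewrite scale0r.
by case: kl; apply: val_inj.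
Qed.

Lemma initial_span_leq i j f : (i <= j)%N -> initial_span i f -> initial_span j f.
Proof.
move=> ij [c ->]; apply: (big_ind (initial_span j)).
- exact: initial_span0.
- by move=> ? ?; apply: initial_spanD.
- by move=> l _; apply/initial_spanZ/initial_span_basis/(leq_trans _ ij).
Qed.

Lemma initial_span_stable j f : initial_span j f -> initial_span j (S f).
Proof.
move=> [c ->]; exists (fun l => c l * mu l); rewrite linear_sum.
by apply: eq_bigr => l _; rewrite (linearZZ S) S_eigen scalerA.
Qed.

(** Normalise [e j - f], where [f] realises the distance from [e j] to the span up to a factor 2.
    The explicit shape of [v] is kept in order to compute [S v]. *)
Lemma riesz_vector j : exists v, [/\ rnorm v <= 1,
  exists al f, initial_span j f /\ v = al *: (e j - f) &
  forall f, initial_span j f -> 2^-1 <= rnorm (v - f)].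
Proof.
have [M M0 MP] := separated j.
pose D := [set rnorm (e j - f) | f in initial_span j].
have D_lb : lbound D M^-1.
  by move=> _ [f jf <-]; rewrite -[_^-1]mulr1 ler_pdivrMl //; apply: MP.
have D0 : D !=set0 by exists (rnorm (e j - 0)); exists 0 => //; apply: initial_span0.
have infD : 0 < inf D.
  by apply: (@lt_le_trans _ _ M^-1); [rewrite invr_gt0 | apply: lb_le_inf].
have [|_ [f jf <-] fD] := @inf_lt _ D (2 * inf D) D0; first lra.
set r := rnorm _ in fD.
have r0 : 0 < r.
  apply: (lt_le_trans infD); apply: ge_inf; last by exists f.
  by exists M^-1.
have normV : rnorm (r^-1%:C%C : R[i]) = r^-1.
  by rewrite rnorm_real ger0_norm // invr_ge0 ltW.
exists (r^-1%:C%C *: (e j - f)); split.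
- by rewrite rnormZ normV mulVf // gt_eqF.
- by exists r^-1%:C%C, f.
move=> g jg.
have -> : r^-1%:C%C *: (e j - f) - g = r^-1%:C%C *: (e j - (f + r%:C%C *: g)).
  rewrite opprD addrA [RHS]scalerBr scalerA -rmorphM mulVf ?gt_eqF //.
  by rewrite rmorph1 scale1r.
rewrite rnormZ normV ler_pdivlMl //.
apply: (@le_trans _ _ (inf D)); first lra.
apply: ge_inf; first by exists M^-1.
by exists (f + r%:C%C *: g) => //; apply/initial_spanD/initial_spanZ.
Qed.

(** Modulo the span of the earlier vectors, [S (v j)] is [mu j *: v j]. So the [S (v j)] are far
    apart, hence so are the [K (v j)], against compactness. *)
Lemma no_infinite_eigenflag : False.
Proof.
have /choice[v vP] := riesz_vector.
have v_span i j : (i < j)%N -> initial_span j (v i).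
  move=> ij; have [_ [al [f [jf ->]]] _] := vP i.
  apply/initial_spanZ/initial_spanB; first exact: initial_span_basis.
  exact: (initial_span_leq (ltnW ij)).
(* [S] separates by at least 1/2; replacing it by [K] on a vector of norm at most 2 costs at most
   [2 / 16]. *)
have K_far i j : (i < j)%N -> 3 / 8 <= rnorm (K (v j) - K (v i)).
  move=> ij; have [vj1 [al [f [jf vE]]] v_far] := vP j; have [vi1 _ _] := vP i.
  have mu0 : mu j != 0 by rewrite -rnorm_eq0 gt_eqF // (lt_le_trans ltr01).
  have SvE : S (v j) - S (v i) =
      mu j *: (v j - (mu j)^-1 *: (S (v i) - al *: (mu j *: f - S f))).
    have -> : S (v j) = al *: (mu j *: e j - S f) by rewrite vE (linearZZ S) (linearB S) S_eigen.
    rewrite [RHS]scalerBr scalerA divff // scale1r vE.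
    by complex_module_eq R B.
  have S_far : 2^-1 <= rnorm (S (v j) - S (v i)).
    rewrite SvE rnormZ; set g := (mu j)^-1 *: _.
    have jg : initial_span j g.
      apply/initial_spanZ/initial_spanB; first exact/initial_span_stable/v_span.
      by apply/initial_spanZ/initial_spanB; [apply: initial_spanZ | apply: initial_span_stable].
    by apply: (le_trans (v_far g jg)); rewrite ler_peMl ?rnorm_ge0.
  have : S (v j) - S (v i) = (S (v j - v i) - K (v j - v i)) + (K (v j) - K (v i)).
    by rewrite (linearB S) (linearB K); complex_module_eq R B.
  move=> dec; have := rnormD (S (v j - v i) - K (v j - v i)) (K (v j) - K (v i)).
  rewrite -dec; have := SK (v j - v i); have := rnormD (v j) (- v i); rewrite rnormN.
  have := ler_wpM2r (rnorm_ge0 (v j - v i)) d_small; lra.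
have [n|s ss [l lP]] := K_compact (u := v); first by case: (vP n).
have e0 : 0 < (8^-1 : R) by rewrite invr_gt0.
(* As [s] need not be monotone, [m] is taken beyond [s N] to ensure [s N < s m]. *)
have [N NP] := lP _ e0; pose m := maxn N (s N).+1.
have sNm : (s N < s m)%N by apply: leq_trans (ss m); rewrite leq_maxr.
have := K_far _ _ sNm; have := NP N (leqnn N); have := NP m (leq_maxl _ _).
move=> hm hN; have := rnormD (K (v (s m)) - l) (- (K (v (s N)) - l)).
by rewrite rnormN opprB addrA subrK; lra.
Qed.
End InfinitelyManyEigenvectors.
End QuasiCompact.

(** * Values of an element on a connected spectrum *)

Section ConnectedSpectrum.
Context {R : realType} {B : completeNormedModType R[i]}.
Variables (mul : B -> B -> B) (one : B).
Hypothesis B_algebra : is_unital_com_banach_algebra mul one.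

Local Notation power f j := (iter j (mul f) one).

Lemma char_power x f j : is_character mul one x -> x (power f j) = x f ^+ j.
Proof.
move=> x_char; elim: j => [|j IHj]; first by rewrite expr0 (char1 x_char).
by rewrite iterS (charM x_char) IHj exprS.
Qed.

Lemma distance_continuous (c : R[i]) : continuous (fun z : R[i]^o => rnorm (z - c)).
Proof.
move=> z; have z_filter : Filter (nbhs (z : R[i]^o)) by typeclasses eauto.
apply/(@cvgrPdist_le _ _ _ _ z_filter) => e e0.
have e0' : 0 < (e%:C%C : R[i]) by rewrite ltcR.
apply: filterS (@nbhsx_ballx _ (R[i]^o : pseudoMetricType R[i]) z _ e0') => y.
rewrite -ball_normE /= -rnorm_lt => /ltW; apply: le_trans.
have := rnormD (z - y) (y - c); have := rnormD (y - z) (z - c).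
by rewrite !addrA !subrK [rnorm (y - z)]rnormB ler_norml; lra.
Qed.

Lemma char_distance_continuous (f : B) (c : R[i]) :
  continuous (fun x : {ptws B -> R[i]^o} => rnorm (x f - c)).
Proof.
move=> x.
pose p (y : {ptws B -> R[i]^o}) : R[i]^o := y f.
have pc : {for x, continuous p} by exact: (@proj_continuous B (fun=> R[i]^o) f x).
apply: (@continuous_comp _ _ _ p (fun z : R[i]^o => rnorm (z - c)) x pc).
exact: distance_continuous.
Qed.

Hypothesis X_connected : connected (max_ideal_space mul one).

(** The continuous real function [|z f - x f|] maps the connected [X] onto an interval containing 0
    and its positive value at [y]; points at distinct distances have distinct values. *)
Lemma distinct_values f x y n : is_character mul one x -> is_character mul one y ->
  x f != y f -> exists xs : nat -> B -> R[i],
    (forall i, (i < n)%N -> is_character mul one (xs i)) /\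
    (forall i j, (i < n)%N -> (j < n)%N -> xs i f = xs j f -> i = j).
Proof.
move=> x_char y_char xy; pose g (z : {ptws B -> R[i]^o}) := rnorm (z f - x f).
have D0 : 0 < g y by rewrite lt_neqAle rnorm_ge0 eq_sym rnorm_eq0 subr_eq0 eq_sym xy.
have /connected_intervalP g_itv : connected (g @` max_ideal_space mul one).
  apply: connected_continuous_connected X_connected _.
  exact/continuous_subspaceT/char_distance_continuous.
have /choice[xs xsP] i : exists z, (i < n)%N ->
    is_character mul one z /\ g z = g y * (i%:R / n%:R).
  have [i_n|] := ltnP i n; last by exists x.
  have n0 : 0 < n%:R :> R by rewrite ltr0n (leq_ltn_trans (leq0n i)).
  have [|||z z_char zE] := g_itv 0 (g y) _ _ (g y * (i%:R / n%:R)).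
  - by exists x => //; rewrite /g subrr rnorm0.
  - by exists y.
  - rewrite mulr_ge0 ?divr_ge0 ?(ltW D0) //= ler_piMr ?(ltW D0) //.
    by rewrite ler_pdivrMr // mul1r ler_nat ltnW.
  by exists z.
exists xs; split=> [i /xsP[]//|i j i_n j_n ij].
have [_] := xsP i i_n; have [_] := xsP j j_n; rewrite /g ij => -> /mulfI.
rewrite gt_eqF // => /(_ isT) /divIf; rewrite gt_eqF; last first.
  by rewrite ltr0n (leq_ltn_trans (leq0n i)).
by move=> /(_ isT) /eqP; rewrite eqr_nat => /eqP.
Qed.

(* The divided difference of order [j] at [j + 1] distinct points is a bounded
   functional that kills the polynomials of degree less than [j]. *)
Lemma powers_separated f x y j : is_character mul one x -> is_character mul one y ->
  x f != y f -> exists2 M, 0 < M &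
  forall g, initial_span (fun i => power f i) j g -> 1 <= M * rnorm (power f j - g).
Proof.
move=> x_char y_char xy; have [xs [xs_char xs_inj]] := distinct_values j.+1 x_char y_char xy.
pose a : 'rV[R[i]]_j.+1 := \row_i xs i f.
have V_unit : Vandermonde j.+1 a \in unitmx.
  rewrite unitmxE unitfE det_Vandermonde; apply/prodf_neq0 => k _.
  apply/prodf_neq0 => l kl; rewrite !mxE subr_eq0; apply/eqP => /xs_inj.
  by move=> /(_ (ltn_ord l) (ltn_ord k)) lk; rewrite lk ltnn in kl.
(* The column [c] holds the weights of the divided difference: the functional vanishes on the lower
   powers and is 1 on the power [j]. *)
have [c cP] : exists c : 'cV[R[i]]_j.+1, Vandermonde j.+1 a *m c = delta_mx ord_max 0.
  by exists (invmx (Vandermonde j.+1 a) *m delta_mx ord_max 0); rewrite mulKVmx.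
pose psi (g : B) := \sum_(i < j.+1) c i 0 * xs i g.
have psi_power l : (l <= j)%N -> psi (power f l) = (l == j)%:R.
  move=> lj; have lj1 : (l < j.+1)%N by [].
  have := congr1 (fun M : 'cV_j.+1 => M (Ordinal lj1) 0) cP.
  rewrite !mxE eqxx andbT => /= <-; apply: eq_bigr => i _.
  by rewrite !mxE (char_power _ _ (xs_char i (ltn_ord i))) mulrC.
pose M := \sum_(i < j.+1) rnorm (c i 0).
have M0 : 0 <= M by apply: sumr_ge0 => i _; apply: rnorm_ge0.
have psi_bound g : rnorm (psi g) <= M * rnorm g.
  rewrite /psi /M mulr_suml.
  apply: (big_ind2 (fun z r => rnorm z <= r)); first by rewrite rnorm0.
    by move=> z r w t zr wt; apply: (le_trans (rnormD _ _)); apply: lerD.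
  move=> i _; rewrite rnormM ler_wpM2l ?rnorm_ge0 //.
  exact: (char_rnorm B_algebra (xs_char i (ltn_ord i))).
exists (M + 1) => [|g [b ->]]; first by rewrite ltr_wpDl.
have psi1 : psi (power f j - \sum_(l < j) b l *: power f l) = 1.
  have psi_lin al u v : psi (al *: u + v) = al * psi u + psi v.
    rewrite /psi mulr_sumr -big_split; apply: eq_bigr => i _ /=.
    by rewrite (charP (xs_char i (ltn_ord i))) mulrDr mulrCA.
  have -> : psi (power f j - \sum_(l < j) b l *: power f l) =
      psi (power f j) - psi (\sum_(l < j) b l *: power f l).
    by rewrite addrC -scaleN1r psi_lin mulN1r addrC.
  rewrite psi_power // eqxx (_ : psi (\sum_(l < j) _) = 0) ?subr0 //.
  apply: (big_ind (fun u => psi u = 0)).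
  - by rewrite /psi big1 // => i _; rewrite (char0 (xs_char i (ltn_ord i))) mulr0.
  - by move=> u v pu pv; rewrite -[u]scale1r psi_lin pu pv mulr0 addr0.
  - move=> l _; rewrite -[_ *: _]addr0 psi_lin psi_power 1?ltnW // ltn_eqF // mulr0 add0r.
    by rewrite /psi big1 // => i _; rewrite (char0 (xs_char i (ltn_ord i))) mulr0.
have := psi_bound (power f j - \sum_(l < j) b l *: power f l).
rewrite psi1 rnorm1 => H; apply: (le_trans H).
by rewrite ler_wpM2r ?rnorm_ge0 // lerDl.
Qed.

End ConnectedSpectrum.

(** * Riesz operators *)

Section RieszOperators.
Context {R : realType} {B : completeNormedModType R[i]}.

Lemma compact_operator_seq_compact (K : B -> B) : compact_operator K -> seq_compact K.
Proof.
move=> [_ K_compact] u u1.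
have F_proper : ProperFilter ((fun n => K (u n)) @ \oo) by typeclasses eauto.
have [|l [_ l_cluster]] := K_compact _ F_proper.
  exists 0%N => // n _ /=; apply: subset_closure; exists (u n) => //=.
  by have := u1 n; rewrite rnorm_le rmorph1.
have [e e0 n|s ss sl] := cluster_extract (u := fun n => K (u n)) (l := l).
  have e0' : 0 < (e%:C%C : R[i]) by rewrite ltcR.
  have [|_ [[m nm <-]]] := l_cluster [set K (u m) | m in [set m | (n <= m)%N]] _ _
      (nbhsx_ballx l _ e0').
    by exists n => // m nm; exists m.
  by rewrite -ball_normE /= -rnorm_lt rnormB => /ltW le_e; exists m.
by exists s => //; exists l.
Qed.

(** Serves to make [opnorm] a genuine bound, since [sup] of an unbounded set takes a default
    value. *)
Lemma seq_compact_bounded (K : B -> B) : seq_compact K ->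
  exists M, forall f, rnorm f <= 1 -> rnorm (K f) <= M.
Proof.
move=> K_compact; apply: contrapT => no_M.
have /choice[u uP] n : exists f, rnorm f <= 1 /\ n%:R < rnorm (K f).
  apply: contrapT => no_f; apply: no_M; exists n%:R => f f1.
  by rewrite leNgt; apply/negP => lt_f; apply: no_f; exists f.
have [n|s ss [l lP]] := K_compact u; first by case: (uP n).
have [N NP] := lP 1 ltr01; pose m := maxn N (Num.truncn (rnorm l + 1)).+1.
have := NP m (leq_maxl _ _); have [_] := uP (s m).
have : rnorm l + 1 <= (s m)%:R.
  apply: (le_trans (ltW (truncnS_gt _))); rewrite ler_nat.
  by apply: leq_trans (ss m); apply: leq_maxr.
by have := rnorm_sub_le (K (u (s m))) l; lra.
Qed.

Lemma bounded_operatorP (S : B -> B) : bounded_operator S ->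
  exists2 a, 0 <= a & forall f, rnorm (S f) <= a * rnorm f.
Proof.
move=> [_ [M MP]]; exists (rnorm M) => [|f]; first exact: rnorm_ge0.
have Mf0 : 0 <= M * `|f| by apply: le_trans (normr_ge0 _) (MP f).
by rewrite rnorm_le rmorphM /= -!rnormE -[`|f|]normr_id -normrM ger0_norm.
Qed.

(** Makes the set under the infimum in [ess_dist] nonempty. *)
Lemma zero_compact : compact_operator (fun _ : B => 0 : B).
Proof.
split; first by move=> a f g; rewrite scaler0 addr0.
rewrite (_ : _ @` _ = [set 0]); last first.
  apply/seteqP; split=> [_ [f _ <-]//|_ ->].
  by exists 0 => //=; rewrite normr0 ler01.
have /closure_id <- : closed [set (0 : B)].
  by apply: accessible_closed_set1; apply: hausdorff_accessible; apply: norm_hausdorff.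
exact: compact_set1.
Qed.

Lemma riesz_quasi_compact (T : B -> B) d : 0 < d -> riesz_operator T ->
  exists N (K : {linear B -> B}), [/\ (0 < N)%N, seq_compact K &
    forall f, rnorm (iter N T f - K f) <= d * rnorm f].
Proof.
move=> d0 [T_bounded T_riesz]; have [T_lin _] := T_bounded.
have [a a0 aP] := bounded_operatorP T_bounded.
(* With the bound at most 1, a small [n]-th root of a nonnegative number forces the number itself
   below [d1]. *)
pose d1 := Num.min d 1; have d10 : 0 < d1 by rewrite lt_min d0 ltr01.
have /cvgrPdist_lt /(_ _ d10) [N _ NP] := T_riesz.
(* The index [N.+1] keeps the root exponent away from the inverse of 0. *)
have ess_small : ess_dist T N.+1 < d1.
  have := NP N.+1 (leqnSn N); rewrite /= sub0r normrN ger0_norm ?powR_ge0 //.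
  set e := ess_dist _ _ => lt_d1; rewrite ltNge; apply/negP => le_e.
  have e0 : 0 <= e by apply: le_trans le_e; apply: ltW.
  have : (e `^ (N.+1%:R)^-1) ^+ N.+1 = e.
    by rewrite -powR_mulrn ?powR_ge0 // -powRrM mulVf ?powRr1 // pnatr_eq0.
  move=> eE; have : e <= e `^ (N.+1%:R)^-1.
    rewrite -{1}eE exprS ler_piMr ?powR_ge0 // exprn_ile1 ?powR_ge0 //.
    by apply: (le_trans (ltW lt_d1)); rewrite ge_min lexx orbT.
  by move=> /(le_trans le_e) /(lt_le_trans lt_d1); rewrite ltxx.
have [|_ [K K_compact <-] K_near] := inf_lt _ ess_small.
  by eexists; exists (fun=> 0); [exact: zero_compact|].
have K_seq := compact_operator_seq_compact K_compact.
have [K_lin _] := K_compact.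
exists N.+1, (linear_of K_lin); split=> // f.
pose TT := linear_of T_lin.
pose D (g : B) := iter N.+1 T g - K g.
have D_lin : linear D.
  move=> al g h; rewrite /D (iter_linear TT) K_lin.
  by rewrite opprD addrACA scalerBr.
have [M MP] := seq_compact_bounded K_seq.
have D_le g : rnorm g <= 1 -> rnorm (D g) <= d.
  move=> g1; apply: (@le_trans _ _ (opnorm D)); last first.
    by apply: (le_trans (ltW K_near)); rewrite ge_min lexx.
  have g1' : `|g| <= 1 by move: g1; rewrite rnorm_le rmorph1.
  apply: ub_le_sup; last by exists g.
  exists (a ^+ N.+1 + M) => _ [h h1 <-].
  have h1' : rnorm h <= 1 by rewrite rnorm_le rmorph1.
  apply: (le_trans (rnormD _ _)); rewrite rnormN lerD ?MP //.
  apply: (le_trans (iter_contraction _ _ a0 aP)).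
  by rewrite ler_piMr // exprn_ge0.
have [->|f0] := eqVneq f 0.
  have -> : iter N.+1 T 0 = 0 by rewrite -(scale0r (0 : B)) (iterZ TT) !scale0r.
  by rewrite linear0 subr0 rnorm0 mulr0.
have nf0 : 0 < rnorm f by rewrite lt_neqAle rnorm_ge0 eq_sym rnorm_eq0 f0.
have normV : rnorm ((rnorm f)^-1%:C%C : R[i]) = (rnorm f)^-1.
  by rewrite rnorm_real gtr0_norm // invr_gt0.
have := D_le ((rnorm f)^-1%:C%C *: f); rewrite rnormZ normV mulVf ?gt_eqF // lexx.
have -> : D ((rnorm f)^-1%:C%C *: f) = (rnorm f)^-1%:C%C *: D f.
  exact: (linearZZ (linear_of D_lin)).
by rewrite rnormZ normV ler_pdivrMl // mulrC => /(_ isT).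
Qed.
End RieszOperators.

(** * Riesz endomorphisms *)

Section RieszEndomorphisms.
Context {R : realType} {B : completeNormedModType R[i]}.
Variables (mul : B -> B -> B) (one : B) (T : B -> B).
Hypothesis B_algebra : is_unital_com_banach_algebra mul one.
Hypothesis B_semisimple : semisimple mul one.
Hypothesis X_connected : connected (max_ideal_space mul one).
Hypothesis T_endo : unital_endomorphism mul one T.
Hypothesis T_riesz : riesz_operator T.

Lemma endo_linear : linear T. Proof. by case: T_endo. Qed.
Lemma endoM f g : T (mul f g) = mul (T f) (T g). Proof. by case: T_endo. Qed.
Lemma endo_one : T one = one. Proof. by case: T_endo. Qed.

Local Notation TT := (linear_of endo_linear).

Lemma endoZ a f : T (a *: f) = a *: T f. Proof. exact: (linearZZ TT). Qed.
Lemma endoD f g : T (f + g) = T f + T g. Proof. exact: (linearD TT). Qed.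
Lemma endoB f g : T (f - g) = T f - T g. Proof. exact: (linearB TT). Qed.

Lemma iter_endo_one n : iter n T one = one.
Proof. by elim: n => // n IHn; rewrite iterS IHn endo_one. Qed.

Lemma iter_endoM n f g : iter n T (mul f g) = mul (iter n T f) (iter n T g).
Proof. by elim: n => // n IHn; rewrite !iterS IHn endoM. Qed.

Lemma iter_endo_char x n : is_character mul one x ->
  is_character mul one (fun f => x (iter n T f)).
Proof.
move=> x_char; split=> [a f g|f g|].
- by rewrite (iter_linear TT) (charP x_char).
- by rewrite iter_endoM (charM x_char).
- by rewrite iter_endo_one (char1 x_char).
Qed.

(* If [g] were not constant on the connected space [X], its powers would be an
   infinite flag of eigenvectors for eigenvalues of modulus at least [1]. *)
Lemma eigenvector_constant x mu g : is_character mul one x ->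
  1 <= rnorm mu -> T g = mu *: g -> g = x g *: one.
Proof.
move=> x_char mu1 Tg; apply/eqP; rewrite -subr_eq0; apply/eqP.
apply: (semisimple_eq0 B_algebra B_semisimple) => y y_char.
rewrite (charB y_char) (charZ y_char) (char1 y_char) mulr1; apply/eqP.
rewrite subr_eq0; apply: contrapT => /negP yx.
have d0 : 0 < (16^-1 : R) by rewrite invr_gt0.
have [N [K [N0 K_seq K_near]]] := riesz_quasi_compact d0 T_riesz.
pose e j := iter j (mul g) one.
have T_power j : T (e j) = mu ^+ j *: e j.
  elim: j => [|j IHj]; first by rewrite expr0 scale1r /e /= endo_one.
  rewrite /e iterS endoM -/(e j) IHj Tg.
  case: B_algebra => -[_ mulC _ _] [mulZl _ _].
  by rewrite mulZl mulC mulZl mulC scalerA exprS.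
have S_eigen j : linear_of (iter_linear TT N) (e j) = (mu ^+ j) ^+ N *: e j.
  have : forall n, iter n T (e j) = (mu ^+ j) ^+ n *: e j; last by apply.
  elim=> [|n IHn]; first by rewrite expr0 scale1r.
  by rewrite iterS IHn endoZ T_power scalerA -exprSr.
apply: (@no_infinite_eigenflag _ _ (linear_of (iter_linear TT N)) K 16^-1 K_seq (lexx _)
  K_near e (fun j => (mu ^+ j) ^+ N) S_eigen) => j.
- by rewrite !rnormX !exprn_ege1.
- exact: (powers_separated B_algebra X_connected j y_char x_char yx).
Qed.

(** * The operator modulo constants *)

Section Normalised.
Variables (x : B -> R[i]) (x_char : is_character mul one x).

Lemma normalise_linear : linear (fun f => f - x f *: one).
Proof.
move=> a f g; rewrite (charP x_char).
by complex_module_eq R B.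
Qed.

(** The projection onto the kernel of [x] along the constants. *)
Definition normalise : {linear B -> B} := linear_of normalise_linear.

Lemma normaliseE f : normalise f = f - x f *: one. Proof. by []. Qed.

Lemma normalise_le f : rnorm (normalise f) <= (1 + rnorm one) * rnorm f.
Proof.
rewrite normaliseE; apply: (le_trans (rnormD _ _)); rewrite rnormN rnormZ mulrDl mul1r.
by rewrite lerD2l mulrC ler_wpM2l ?rnorm_ge0 // (char_rnorm B_algebra x_char).
Qed.

Lemma char_normalise f : x (normalise f) = 0.
Proof. by rewrite normaliseE (charB x_char) (charZ x_char) (char1 x_char) mulr1 subrr. Qed.

Lemma normalised_endo_linear : linear (fun f => normalise (T f)).
Proof. by move=> a f g; rewrite endo_linear linearP. Qed.

Definition normalised_endo : {linear B -> B} := linear_of normalised_endo_linear.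
Local Notation A := normalised_endo.

Lemma normalised_endoE f : A f = T f - x (T f) *: one. Proof. by []. Qed.

(** [T] preserves constants, so projecting before applying [T] changes nothing after the final
    projection. *)
Lemma iter_normalised_endo n f : iter n.+1 A f = normalise (iter n.+1 T f).
Proof.
elim: n => // n IHn; rewrite iterS IHn !normaliseE normalised_endoE.
rewrite endoB endoZ endo_one -iterS (charB x_char) (charZ x_char) (char1 x_char).
by complex_module_eq R B.
Qed.

(** An eigenvector of [A] satisfies [T f = mu f + c] with [x f = 0]; it is corrected to an
    eigenvector of [T], which is constant. *)
Lemma normalised_endo_no_eigenvector mu f : 1 <= rnorm mu -> A f = mu *: f -> f = 0.
Proof.
move=> mu1 Af.
have mu0 : mu != 0 by rewrite -rnorm_eq0 gt_eqF // (lt_le_trans ltr01).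
have xf : x f = 0.
  have := char_normalise (T f); rewrite -[normalise _]/(A f) Af (charZ x_char).
  by move/eqP; rewrite mulf_eq0 (negPf mu0) => /eqP.
set c := x (T f); have Tf : T f = mu *: f + c *: one.
  by apply/eqP; rewrite -subr_eq -Af normalised_endoE.
(* For [mu = 1], [T^n f = f + n c]; the characters [x o T^n] are bounded by the norm, so
   [n |c| <= |f|] for all positive [n]. *)
have [mu_1|mu_n1] := eqVneq mu 1.
  have Tn n : iter n T f = f + (n%:R * c) *: one.
    elim: n => [|n IHn]; first by rewrite mul0r scale0r addr0.
    rewrite iterS IHn endoD endoZ endo_one Tf mu_1 -natr1.
    by complex_module_eq R B.
  have c0 : c = 0.
    apply: rnorm_small => e e0; have [n nP] : exists n, rnorm f <= n.+1%:R * e.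
      exists (Num.truncn (rnorm f / e)); rewrite -ler_pdivrMr // ltW //.
      exact: truncnS_gt.
    have := char_rnorm B_algebra (iter_endo_char n.+1 x_char) f.
    rewrite Tn (charD x_char) xf add0r (charZ x_char) (char1 x_char) mulr1 rnormM.
    have -> : rnorm (n.+1%:R : R[i]) = n.+1%:R.
      by have := rnorm_real (n.+1%:R : R); rewrite rmorph_nat ger0_norm.
    by move=> /le_trans /(_ nP); rewrite ler_pM2l.
  have Tff : T f = 1 *: f by rewrite Tf c0 mu_1 scale0r addr0.
  by rewrite (eigenvector_constant x_char _ Tff) ?rnorm1 // xf scale0r.
(* This shift solves [c + d = mu d]. *)
pose d := c / (mu - 1); have mu1' : mu - 1 != 0 by rewrite subr_eq0.
have Tfd : T (f + d *: one) = mu *: (f + d *: one).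
  rewrite endoD endoZ endo_one Tf /d.
  by complex_module_eq R B; field.
have := eigenvector_constant x_char mu1 Tfd.
rewrite (charD x_char) xf add0r (charZ x_char) (char1 x_char) mulr1.
by move/(canRL (addrK _)); rewrite subrr.
Qed.

Lemma normalised_endo_iterates_small f e : 0 < e ->
  exists n, rnorm (iter n.+1 A f) <= e.
Proof.
have one0 := rnorm_ge0 one; have norm1 : 0 < 1 + rnorm one by rewrite ltr_wpDr.
(* The projection has norm at most [1 + |one|], so [A^(N+1)] is within 1/2 of the compact
   [normalise o K]. *)
have d0 : 0 < 2^-1 / (1 + rnorm one) by rewrite divr_gt0.
have [[|N] [K [// _ K_seq K_near]]] := riesz_quasi_compact d0 T_riesz.
have [a a0 aP] := bounded_operatorP T_riesz.1.
have A_bounded g : rnorm (A g) <= (1 + rnorm one) * a * rnorm g.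
  by apply: (le_trans (normalise_le _)); rewrite -mulrA ler_pM2l.
have b0 : 0 <= (1 + rnorm one) * a by rewrite mulr_ge0 // ltW.
have PK_lin : linear (fun g => normalise (K g)) by move=> al g h; rewrite !linearP.
have PK_seq : seq_compact (linear_of PK_lin).
  move=> u /K_seq[s ss [l lP]]; exists s => //; exists (normalise l) => r r0.
  have r0' : 0 < r / (1 + rnorm one) by rewrite divr_gt0.
  have [M MP] := lP _ r0'; exists M => n /MP; rewrite ler_pdivlMr // mulrC.
  by apply: le_trans; rewrite -[X in rnorm X]/(normalise _ - _) -linearB normalise_le.
have A_near g : rnorm (iter N.+1 A g - linear_of PK_lin g) <= 2^-1 * rnorm g.
  rewrite iter_normalised_endo -[linear_of _ _]/(normalise (K g)) -(linearB normalise).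
  apply: (le_trans (normalise_le _)); rewrite mulrC -ler_pdivlMr //.
  by rewrite mulrAC.
have rnorm_semi : seminorm (rnorm : B -> R) by split; [exact: rnormD | exact: rnormZ].
have half1 : (2^-1 : R) < 1 by rewrite invf_lt1 ?ltr1n.
have [C C0 CP] := uniformly_bounded_below rnorm_semi b0 A_bounded
  (quasi_compact_bounded_below b0 A_bounded PK_seq half1 A_near normalised_endo_no_eigenvector).
have [k kP] := contraction_of_bounded_below rnorm_semi A_bounded CP b0 C0.
move=> e0.
have f0 : 0 < e / (rnorm f + 1) by rewrite divr_gt0 // ltr_wpDl ?rnorm_ge0.
have [j jP] := half_pow_small f0.
have small : rnorm (iter (j.+1 * 2 ^ k) A f) <= e.
  have half0 : 0 <= (2^-1 : R) by rewrite invr_ge0.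
  have := iter_contraction j.+1 f half0 kP.
  have -> : iter j.+1 (iter (2 ^ k) A) f = iter (j.+1 * 2 ^ k) A f.
    elim: j.+1 => // i IHi; by rewrite iterS IHi mulSn iterD.
  move=> /le_trans; apply; move: jP; rewrite ler_pdivlMr ?ltr_wpDl ?rnorm_ge0 //.
  have p0 : 0 <= (2^-1 : R) ^+ j by rewrite exprn_ge0.
  have := mulr_ge0 p0 (rnorm_ge0 f); rewrite exprS; lra.
by exists (j.+1 * 2 ^ k).-1; rewrite prednK // muln_gt0 expn_gt0.
Qed.

Lemma iterates_nearly_constant f e : 0 < e -> exists n, forall y,
  is_character mul one y -> rnorm (y (iter n T f) - x (iter n T f)) <= e.
Proof.
move=> /(normalised_endo_iterates_small f)[n nP]; exists n.+1 => y y_char.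
apply: le_trans nP; rewrite iter_normalised_endo.
apply: le_trans (char_rnorm B_algebra y_char _).
by rewrite normaliseE (charB y_char) (charZ y_char) (char1 y_char) mulr1.
Qed.
End Normalised.

(** Each defining identity involves at most three elements, so approximation by one character at
    three elements suffices. *)
Lemma limit_character (x0 : B -> R[i]) :
  (forall f g h e, 0 < e -> exists y, [/\ is_character mul one y, rnorm (y f - x0 f) <= e,
     rnorm (y g - x0 g) <= e & rnorm (y h - x0 h) <= e]) ->
  is_character mul one x0.
Proof.
move=> lim; split=> [a f g|f g|].
- apply/eqP; rewrite -subr_eq0; apply/eqP/rnorm_small => e e0.
  have a0 : 0 < 2 + rnorm a by rewrite ltr_wpDr ?rnorm_ge0.
  have e0' : 0 < e / (2 + rnorm a) by rewrite divr_gt0.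
  have [y [y_char yf yg yh]] := lim f g (a *: f + g) _ e0'.
  have -> : x0 (a *: f + g) - (a *: x0 f + x0 g) =
     a * (y f - x0 f) + (y g - x0 g) - (y (a *: f + g) - x0 (a *: f + g)).
    by rewrite (charP y_char) -[a *: x0 f]/(a * x0 f); ring.
  move: yf yg yh; set r := e / _ => yf yg yh.
  have -> : e = r * (2 + rnorm a) by rewrite divfK // gt_eqF.
  have h1 := rnormD (a * (y f - x0 f) + (y g - x0 g)) (- (y (a *: f + g) - x0 (a *: f + g))).
  have h2 := rnormD (a * (y f - x0 f)) (y g - x0 g).
  have h3 := ler_wpM2l (rnorm_ge0 a) yf.
  by move: h1 h2 h3; rewrite rnormN rnormM; lra.
- apply/eqP; rewrite -subr_eq0; apply/eqP/rnorm_small => e e0.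
  (* The sum of the weights 1, [|y f| <= |f|] and [|x0 g|] of the three errors. *)
  pose b := 1 + rnorm f + rnorm (x0 g).
  have b0 : 0 < b by rewrite !ltr_wpDr ?rnorm_ge0.
  have e0' : 0 < e / b by rewrite divr_gt0.
  have [y [y_char yf yg yh]] := lim f g (mul f g) _ e0'.
  have -> : x0 (mul f g) - x0 f * x0 g =
     y f * (y g - x0 g) + x0 g * (y f - x0 f) - (y (mul f g) - x0 (mul f g)).
    by rewrite (charM y_char); ring.
  move: yf yg yh; set r := e / _ => yf yg yh.
  have -> : e = r * b by rewrite divfK // gt_eqF.
  have h1 := rnormD (y f * (y g - x0 g) + x0 g * (y f - x0 f))
    (- (y (mul f g) - x0 (mul f g))).
  have h2 := rnormD (y f * (y g - x0 g)) (x0 g * (y f - x0 f)).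
  have h3 := ler_wpM2l (rnorm_ge0 (x0 g)) yf.
  have h4 := ler_pM (rnorm_ge0 (y f)) (rnorm_ge0 _) (char_rnorm B_algebra y_char f) yg.
  by move: h1 h2 h3 h4; rewrite rnormN !rnormM /b; lra.
- apply/eqP; rewrite -subr_eq0; apply/eqP/rnorm_small => e e0.
  have [y [y_char y1 _ _]] := lim one one one _ e0.
  by rewrite rnormB -(char1 y_char).
Qed.

(** [x (T^(N+k) f)] is the value at [T^N f] of the character [x o T^k], so near-constancy makes the
    sequence Cauchy; its limit is invariant under the shift by [T]. *)
Lemma exists_fixed_character : exists x0, is_character mul one x0 /\
  forall f, x0 (T f) = x0 f.
Proof.
have [x x_char] := exists_character B_algebra B_semisimple.
have cauchy_f f : rcauchy (fun n => x (iter n T f)).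
  move=> e e0; have e20 : 0 < e / 2 by rewrite divr_gt0.
  have [N NP] := iterates_nearly_constant x_char f e20.
  have near_N n : (N <= n)%N -> rnorm (x (iter n T f) - x (iter N T f)) <= e / 2.
    move=> /subnKC <-; rewrite addnC iterD.
    exact: NP (iter_endo_char _ x_char).
  exists N => m n /near_N hm /near_N hn.
  have -> : x (iter m T f) - x (iter n T f) =
      (x (iter m T f) - x (iter N T f)) - (x (iter n T f) - x (iter N T f)) by ring.
  by apply: (le_trans (rnormD _ _)); rewrite rnormN; lra.
have /choice[x0 x0P] f : exists l, rcvg (fun n => x (iter n T f)) l.
  exact: complex_rcauchy_rcvg.
exists x0; split=> [|f].
  apply: limit_character => f g h e e0.
  have [N1 H1] := x0P f e e0; have [N2 H2] := x0P g e e0; have [N3 H3] := x0P h e e0.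
  exists (fun u => x (iter (maxn N1 (maxn N2 N3)) T u)); split.
  - exact: iter_endo_char.
  - by apply: H1; rewrite leq_maxl.
  - by apply: H2; rewrite leq_max leq_maxl orbT.
  - by apply: H3; rewrite !leq_max leqnn !orbT.
apply: (rcvg_unique (u := fun n => x (iter n T (T f)))); first exact: x0P.
move=> e /(x0P f)[N NP]; exists N => n Nn; rewrite -iterSr.
by apply: NP; apply: leqW.
Qed.
End RieszEndomorphisms.

(** * The intersection of the ranges and the fixed point *)

Theorem theorem1p1 (R : realType) (B : completeNormedModType R[i])
    (mul : B -> B -> B) (one : B)
    (T : B -> B) (phi : {ptws B -> R[i]^o} -> {ptws B -> R[i]^o}) :
  is_unital_com_banach_algebra mul one ->
  semisimple mul one ->
  connected (max_ideal_space mul one) ->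
  unital_endomorphism mul one T ->
  riesz_operator T ->
  induced_by mul one T phi ->
  exists x0 : {ptws B -> R[i]^o},
    [/\ max_ideal_space mul one x0,
        \bigcap_(n in [set: nat]) (iter n phi @` max_ideal_space mul one)
          = [set x0],
        phi x0 = x0 &
        (forall y, max_ideal_space mul one y -> phi y = y -> y = x0)].
Proof.
move=> B_algebra B_semisimple X_connected T_endo T_riesz [phi_X _ phiE].
have [x0 [x0_char x0T]] :=
  exists_fixed_character B_algebra B_semisimple X_connected T_endo T_riesz.
have phi_x0 : phi x0 = x0 by apply/funext => f; rewrite -phiE ?x0T.
have iter_phi_X n y : max_ideal_space mul one y -> max_ideal_space mul one (iter n phi y).
  by move=> y_char; elim: n => // n IHn; apply: phi_X.
have iter_phiE n y f : max_ideal_space mul one y -> iter n phi y f = y (iter n T f).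
  move=> y_char; elim: n f => // n IHn f.
  by rewrite iterS -phiE ?IHn -?iterSr //; apply: iter_phi_X.
have x0Tn n f : x0 (iter n T f) = x0 f.
  by elim: n => // n IHn; rewrite iterS x0T.
(* If [y] is the [n]-th iterate at [z], then [y f = z (T^n f)], which is close to
   [x0 (T^n f) = x0 f]. *)
have range_phi y : (forall n, (iter n phi @` max_ideal_space mul one) y) -> y = x0.
  move=> y_range; apply/funext => f; apply/eqP; rewrite -subr_eq0; apply/eqP.
  apply: rnorm_small => e e0.
  have [n nP] := iterates_nearly_constant B_algebra B_semisimple X_connected T_endo T_riesz
    x0_char f e0.
  have [z z_char zy] := y_range n.
  by rewrite -zy iter_phiE // -(x0Tn n f); apply: nP.
have fixed_iter y n : phi y = y -> iter n phi y = y.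
  by move=> phi_y; elim: n => // n IHn; rewrite iterS IHn.
exists x0; split=> //.
- apply/seteqP; split=> [y y_range|_ -> n _].
    by apply: range_phi => n; apply: y_range.
  by exists x0 => //; apply: fixed_iter.
(* A fixed point lies in the range of every iterate. *)
- by move=> y y_char phi_y; apply: range_phi => n; exists y => //; apply: fixed_iter.
Qed.
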